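(* Let $(\mathcal{A},A,A')$ be a quasi-twilled associative algebra with multiplication $\Omega=\pi+\xi+\eta+\beta+\rho+\mu+\theta$. Then there is a curved $V$-data $(L,F,P,\Delta)$ as follows: (i) the graded Lie algebra $(L,[\cdot,\cdot])$ is $\left(\bigoplus_{n=0}^{+\infty}\mathrm{Hom}(\otimes^{n+1}(A\oplus A'),A\oplus A'),[\cdot,\cdot]_G\right)$; (ii) the abelian graded Lie subalgebra is $F=\bigoplus_{n=0}^{+\infty}\mathrm{Hom}(\otimes^{n+1}A,A')$; (iii) $P:L\to L$ is the projection onto the subspace $F$; (iv) $\Delta=\pi+\xi+\eta+\beta+\rho+\mu+\theta$. Consequently, $\left(\bigoplus_{n=0}^{+\infty}\mathrm{Hom}(\otimes^{n+1}A,A'),l_0,l_1,l_2\right)$ is a curved $L_\infty$-algebra, where $$l_0=\theta,\qquad l_1(f)=[\pi+\rho+\mu,f]_G,\qquad l_2(f,g)=[[\xi+\eta+\beta,f]_G,g]_G$$ for all $f\in\mathrm{Hom}(\otimes^mA,A')$ and $g\in\mathrm{Hom}(\otimes^nA,A')$ (and $l_k=0$ for $k\ge 3$). Furthermore, a linear map $D:A\to A'$ is a right deformation map of $(\mathcal{A},A,A')$ if and only if $D$ is a Maurer-Cartan element of this curved $L_\infty$-algebra.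
   Context: All vector spaces are over a field $\mathbb{K}$ of characteristic $0$; associative algebras are not assumed unital. Gerstenhaber bracket: for a vector space $W$, $\bigoplus_{n\ge0}\mathrm{Hom}(\otimes^{n+1}W,W)$ is graded by giving $\mathrm{Hom}(\otimes^{n+1}W,W)$ degree $n$. For $f\in\mathrm{Hom}(\otimes^mW,W)$, $g\in\mathrm{Hom}(\otimes^nW,W)$, $[f,g]_G=f\circ g-(-1)^{(m-1)(n-1)}g\circ f$, where $f\circ g(x_1,\dots,x_{m+n-1})=\sum_{i=1}^m(-1)^{(i-1)(n-1)}f(x_1,\dots,x_{i-1},g(x_i,\dots,x_{i+n-1}),x_{i+n},\dots,x_{m+n-1})$. This is a graded Lie algebra. Lift convention: a multilinear map $f$ from a tensor product of copies of $A$ and $A'$ (in a fixed order) to $A$ or $A'$ is regarded as an element of $\mathrm{Hom}(\otimes^n(A\oplus A'),A\oplus A')$ by extending it by zero on all other tensor components. So $\mathrm{Hom}(\otimes^n(A\oplus A'),A\oplus A')$ is the direct sum of all such component spaces, and $P$ is the projection onto the components $\mathrm{Hom}(\otimes^{n+1}A,A')$ along all other components. A quasi-twilled associative algebra $(\mathcal{A},A,A')$ is an associative algebra $(\mathcal{A},\Omega)$ with a vector space decomposition $\mathcal{A}=A\oplus A'$ such that $A'$ is a subalgebra. Then uniquely $\Omega=\pi+\xi+\eta+\beta+\rho+\mu+\theta$ with $\pi\in\mathrm{Hom}(A\otimes A,A)$, $\xi\in\mathrm{Hom}(A\otimes A',A)$, $\eta\in\mathrm{Hom}(A'\otimes A,A)$,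 $\beta\in\mathrm{Hom}(A'\otimes A',A')$, $\rho\in\mathrm{Hom}(A\otimes A',A')$, $\mu\in\mathrm{Hom}(A'\otimes A,A')$, $\theta\in\mathrm{Hom}(A\otimes A,A')$, i.e. $\Omega((x,u),(y,v))=(\pi(x,y)+\xi(x,v)+\eta(u,y),\ \beta(u,v)+\rho(x,v)+\mu(u,y)+\theta(x,y))$ for $x,y\in A$, $u,v\in A'$. A right deformation map of $(\mathcal{A},A,A')$ is a linear map $D:A\to A'$ such that for all $x,y\in A$: $D(\pi(x,y)+\xi(x,D(y))+\eta(D(x),y))=\rho(x,D(y))+\mu(D(x),y)+\beta(D(x),D(y))+\theta(x,y)$. A curved $V$-data is a quadruple $(L,F,P,\Delta)$ where $(L=\bigoplus L^i,[\cdot,\cdot])$ is a graded Lie algebra, $F$ is an abelian graded Lie subalgebra of $L$, $P:L\to L$ is a projection ($P\circ P=P$) whose image is $F$ and whose kernel is a graded Lie subalgebra of $L$, and $\Delta\in L^1$ satisfies $[\Delta,\Delta]=0$. A curved $L_\infty$-algebra is a $\mathbb{Z}$-graded vector space $\mathfrak{g}$ with linear maps $l_k:\otimes^k\mathfrak{g}\to\mathfrak{g}$ ($k\ge0$) of degree $1$ that are graded symmetric, $l_n(x_{\sigma(1)},\dots,x_{\sigma(n)})=\varepsilon(\sigma)l_n(x_1,\dots,x_n)$ for $\sigma\in S_n$, and satisfy for all $n\ge0$: $\sum_{i=0}^n\sum_{\sigma\in S(i,n-i)}\varepsilon(\sigma)l_{n-i+1}(l_i(x_{\sigma(1)},\dots,x_{\sigma(i)}),x_{\sigma(i+1)},\dots,x_{\sigma(n)})=0$,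 where $\varepsilon(\sigma)$ is the Koszul sign, $S(i,n-i)$ is the set of $(i,n-i)$-shuffles, and the $x_j$ are homogeneous. A Maurer-Cartan element is a degree $0$ element $x$ with $l_0+\sum_{k\ge1}\frac{1}{k!}l_k(x,\dots,x)=0$. Here $\mathrm{Hom}(\otimes^{n+1}A,A')$ has degree $n$. *)

(* Defs.v *)
From HB Require Import structures.
From mathcomp Require Import all_boot all_order all_fingroup all_algebra.
From mathcomp Require Import zify.
From mathcomp Require Import boolp classical_sets functions.

Set Implicit Arguments.
Unset Strict Implicit.
Unset Printing Implicit Defensive.

Import GRing.Theory.
Local Open Scope ring_scope.
Local Open Scope classical_set_scope.

Definition upd (n : nat) (U : Type) (x : 'I_n -> U) (i : 'I_n) (u : U) :
  'I_n -> U := fun j => if j == i then u else x j.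

Definition multilinear (K : fieldType) (U V : lmodType K) n
    (f : ('I_n -> U) -> V) : Prop :=
  forall (x : 'I_n -> U) (i : 'I_n) (a : K) (u v : U),
    f (upd x i (a *: u + v)) = a *: f (upd x i u) + f (upd x i v).

Section MultilinearPred.
Variables (K : fieldType) (n : nat) (U V : lmodType K).

Definition multilinear_pred : {pred ('I_n -> U) -> V} :=
  fun f => `[< multilinear f >].

Lemma multilinear_submod : submod_closed multilinear_pred.
Proof.
split=> [|a f g /asboolP fM /asboolP gM]; apply/asboolP => x i b u v.
  by rewrite scaler0 addr0.
have E y : (a *: f + g) y = a *: f y + g y by [].
by rewrite !E fM gM !scalerDr !scalerA (mulrC a b) -!addrA; congr (_ + _);
  rewrite addrCA.
Qed.

HB.instance Definition _ := GRing.isSubmodClosed.Build K _ multilinear_pred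
  multilinear_submod.

End MultilinearPred.

(* Hom of the n-th tensor power of U to V, represented (by the universal       *)
(* property of the tensor power) as the space of n-linear maps.                *)
Record hom (K : fieldType) (n : nat) (U V : lmodType K) := Hom {
  hom_fun :> ('I_n -> U) -> V;
  _ : @multilinear_pred K n U V hom_fun }.

Section HomLmodule.
Variables (K : fieldType) (n : nat) (U V : lmodType K).

HB.instance Definition _ := [isSub for @hom_fun K n U V].
HB.instance Definition _ := [Choice of hom n U V by <:].
HB.instance Definition _ := [SubChoice_isSubLmodule of hom n U V by <:].

Lemma hom_multilinear (f : hom n U V) : multilinear f.
Proof. by case: f => f /= /asboolP. Qed.

Lemma homE (f g : hom n U V) : f =1 g -> f = g.
Proof. by move=> fg; apply/val_inj/funext. Qed.

Lemma hom_zero (f : hom n U V) x i : x i = 0 -> f x = 0.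
Proof.
move=> x0; have E : x = upd x i (-1 *: 0 + 0).
  by apply: funext => j; rewrite /upd scaler0 addr0; case: eqP => // ->.
by rewrite E hom_multilinear scaleN1r addNr.
Qed.

Definition mkhom (f : ('I_n -> U) -> V) (fM : multilinear f) : hom n U V :=
  Hom (asboolT fM).

End HomLmodule.

Record dsum (K : fieldType) (V : nat -> lmodType K) := DSum {
  dsum_fun :> forall n, V n;
  _ : exists N, forall n, (N <= n)%N -> dsum_fun n = 0 }.

Section DsumLmodule.
Variables (K : fieldType) (V : nat -> lmodType K).
Implicit Types x y z : dsum V.

Lemma dsum_finite x : exists N, forall n, (N <= n)%N -> x n = 0.
Proof. by case: x. Qed.

Lemma dsumE x y : (forall n, x n = y n) -> x = y.
Proof.
case: x y => [x xP] [y yP] /= xy.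
have {}xy : x = y by apply: functional_extensionality_dep.
by case: y / xy yP => yP; congr DSum; apply: Prop_irrelevance.
Qed.

HB.instance Definition _ := gen_eqMixin (dsum V).
HB.instance Definition _ := gen_choiceMixin (dsum V).

Fact dsum0_subproof : exists N, forall n, (N <= n)%N -> (0 : V n) = 0.
Proof. by exists 0%N. Qed.
Definition dsum0 : dsum V := DSum dsum0_subproof.

Fact dsumD_subproof x y :
  exists N, forall n, (N <= n)%N -> x n + y n = 0.
Proof.
have [[N xN] [M yM]] := (dsum_finite x, dsum_finite y).
by exists (maxn N M) => n; rewrite geq_max => /andP[/xN-> /yM->]; rewrite addr0.
Qed.
Definition dsumD x y : dsum V := DSum (dsumD_subproof x y).

Fact dsumN_subproof x : exists N, forall n, (N <= n)%N -> - x n = 0.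
Proof. by have [N xN] := dsum_finite x; exists N => n /xN->; rewrite oppr0. Qed.
Definition dsumN x : dsum V := DSum (dsumN_subproof x).

Fact dsumZ_subproof (a : K) x :
  exists N, forall n, (N <= n)%N -> a *: x n = 0.
Proof. by have [N xN] := dsum_finite x; exists N => n /xN->; rewrite scaler0. Qed.
Definition dsumZ a x : dsum V := DSum (dsumZ_subproof a x).

Fact dsumA : associative dsumD.
Proof. by move=> x y z; apply: dsumE => n; apply: addrA. Qed.
Fact dsumC : commutative dsumD.
Proof. by move=> x y; apply: dsumE => n; apply: addrC. Qed.
Fact dsum0D : left_id dsum0 dsumD.
Proof. by move=> x; apply: dsumE => n; apply: add0r. Qed.
Fact dsumND : left_inverse dsum0 dsumN dsumD.
Proof. by move=> x; apply: dsumE => n; apply: addNr. Qed.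

HB.instance Definition _ :=
  GRing.isZmodule.Build (dsum V) dsumA dsumC dsum0D dsumND.

Fact dsumZA a b x : dsumZ a (dsumZ b x) = dsumZ (a * b) x.
Proof. by apply: dsumE => n; apply: scalerA. Qed.
Fact dsum1Z : left_id 1 dsumZ.
Proof. by move=> x; apply: dsumE => n; apply: scale1r. Qed.
Fact dsumZDr : right_distributive dsumZ +%R.
Proof. by move=> a x y; apply: dsumE => n; apply: scalerDr. Qed.
Fact dsumZDl x : {morph dsumZ^~ x : a b / a + b}.
Proof. by move=> a b; apply: dsumE => n; apply: scalerDl. Qed.

HB.instance Definition _ :=
  GRing.Zmodule_isLmodule.Build K (dsum V) dsumZA dsum1Z dsumZDr dsumZDl.

Definition dsum_in_fun n (v : V n) : forall k, V k :=
  fun k => if n =P k is ReflectT e then ecast k (V k) e v else 0.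

Fact dsum_in_subproof n (v : V n) :
  exists N, forall k, (N <= k)%N -> dsum_in_fun v k = 0.
Proof.
exists n.+1 => k nk; rewrite /dsum_in_fun; case: eqP => // e.
by exfalso; move: nk; rewrite e ltnn.
Qed.
Definition dsum_in n (v : V n) : dsum V := DSum (dsum_in_subproof v).

Lemma dsum_in_eq n (v : V n) : dsum_in v n = v.
Proof. by rewrite /= /dsum_in_fun; case: eqP => // e; rewrite eq_axiomK. Qed.

Lemma dsum_in_neq n (v : V n) k : n != k -> dsum_in v k = 0.
Proof. by rewrite /= /dsum_in_fun; case: eqP. Qed.

(* The Z-grading of the direct sum: the n-th summand is the part of degree n,  *)
(* and the parts of negative degree are 0.                                     *)
Definition dsum_deg (i : int) : set (dsum V) :=
  [set x | forall n, n%:Z != i -> x n = 0].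

End DsumLmodule.

Section DsumMap.
Variables (K : fieldType) (V W : nat -> lmodType K).
Variable h : forall n, {linear V n -> W n}.

Fact dsum_map_subproof (x : dsum V) :
  exists N, forall n, (N <= n)%N -> h n (x n) = 0.
Proof. by have [N xN] := dsum_finite x; exists N => n /xN->; rewrite linear0. Qed.
Definition dsum_map (x : dsum V) : dsum W := DSum (dsum_map_subproof x).

End DsumMap.

(* The cochains of degree n are the (n+1)-linear maps. *)
Definition cochains (K : fieldType) (U V : lmodType K) : lmodType K :=
  dsum (fun n => hom n.+1 U V : lmodType K).

Definition cochain_in (K : fieldType) (U V : lmodType K) n
    (f : hom n.+1 U V) : cochains U V :=
  @dsum_in K (fun n => hom n.+1 U V : lmodType K) n f.

Definition cochain_deg (K : fieldType) (U V : lmodType K) :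
  int -> set (cochains U V) := @dsum_deg K (fun n => hom n.+1 U V).
Arguments cochain_deg {K U V}.

Section Graded.
Variables (K : fieldType) (V : lmodType K).

Definition subspace (S : set V) : Prop :=
  S 0 /\ forall (a : K) u v, S u -> S v -> S (a *: u + v).

(* V is the internal direct sum of the subspaces G i. *)
Record grading (G : int -> set V) : Prop := {
  grading_subspace : forall i, subspace (G i);
  grading_span : forall x, exists (s : seq int) (c : int -> V),
    (forall i, G i (c i)) /\ x = \sum_(i <- s) c i;
  grading_free : forall (s : seq int) (c : int -> V),
    uniq s -> (forall i, G i (c i)) -> \sum_(i <- s) c i = 0 ->
    forall i, i \in s -> c i = 0 }.

Definition graded_subspace (G : int -> set V) (S : set V) : Prop :=
  subspace S /\ forall x, S x -> exists (s : seq int) (c : int -> V),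
    (forall i, G i (c i) /\ S (c i)) /\ x = \sum_(i <- s) c i.

Definition ksign (i : int) : K := (-1) ^ i.

Record graded_Lie (G : int -> set V) (br : V -> V -> V) : Prop := {
  gLie_grading : grading G;
  gLie_linearl : forall y, linear (br^~ y);
  gLie_linearr : forall x, linear (br x);
  gLie_degree : forall i j x y, G i x -> G j y -> G (i + j) (br x y);
  gLie_antisym : forall i j x y, G i x -> G j y ->
    br x y = - (ksign (i * j) *: br y x);
  gLie_jacobi : forall i j k x y z, G i x -> G j y -> G k z ->
    br x (br y z) = br (br x y) z + ksign (i * j) *: br y (br x z) }.

Definition graded_Lie_sub (G : int -> set V) (br : V -> V -> V) (S : set V) :
  Prop := graded_subspace G S /\ forall x y, S x -> S y -> S (br x y).

Record curved_Vdata (G : int -> set V) (br : V -> V -> V) (F : set V)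
    (P : V -> V) (Delta : V) : Prop := {
  Vdata_Lie : graded_Lie G br;
  Vdata_sub : graded_Lie_sub G br F;
  Vdata_abelian : forall x y, F x -> F y -> br x y = 0;
  Vdata_linear : linear P;
  Vdata_proj : forall x, P (P x) = P x;
  Vdata_image : range P = F;
  Vdata_kernel : graded_Lie_sub G br [set x | P x = 0];
  Vdata_degree : G 1 Delta;
  Vdata_square : br Delta Delta = 0 }.

(* The Koszul sign of the rearrangement x_1 ... x_n |-> x_s(1) ... x_s(n) of   *)
(* elements of degrees d_1, ..., d_n.                                          *)
Definition koszul n (d : 'I_n -> int) (s : 'S_n) : K :=
  \prod_(i < n) \prod_(j < n | (i < j)%N && (s j < s i)%N)
    ksign (d (s i) * d (s j)).

Definition shuffle n (i : nat) (s : 'S_n) : bool :=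
  [forall a : 'I_n, forall b : 'I_n,
     (a < b)%N && ((b < i)%N || (i <= a)%N) ==> (s a < s b)%N].

Definition fcons n (v : V) (x : 'I_n -> V) : 'I_n.+1 -> V :=
  fun j => oapp x v (unlift ord0 j).

Definition firsts n (i : 'I_n.+1) (x : 'I_n -> V) : 'I_i -> V :=
  fun k => x (cast_ord (subnKC (leq_ord i)) (lshift (n - i) k)).

Definition lasts n (i : 'I_n.+1) (x : 'I_n -> V) : 'I_(n - i) -> V :=
  fun k => x (cast_ord (subnKC (leq_ord i)) (rshift i k)).

Arguments firsts {n} i x.
Arguments lasts {n} i x.

Record curved_Linfty (G : int -> set V)
    (l : forall k, ('I_k -> V) -> V) : Prop := {
  Linfty_grading : grading G;
  Linfty_multilinear : forall k, multilinear (l k);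
  Linfty_degree : forall k (d : 'I_k -> int) (x : 'I_k -> V),
    (forall j, G (d j) (x j)) -> G (\sum_j d j + 1) (l k x);
  Linfty_symmetric : forall k (s : 'S_k) (d : 'I_k -> int) (x : 'I_k -> V),
    (forall j, G (d j) (x j)) ->
    l k (fun j => x (s j)) = koszul d s *: l k x;
  Linfty_relation : forall n (d : 'I_n -> int) (x : 'I_n -> V),
    (forall j, G (d j) (x j)) ->
    \sum_(i < n.+1) \sum_(s : 'S_n | shuffle i s) koszul d s *:
      l (n - i).+1 (fcons (l i (firsts i (fun j => x (s j))))
                          (lasts i (fun j => x (s j)))) = 0 }.

(* The Maurer-Cartan series is required to have finitely many nonzero terms,   *)
(* so that its sum makes sense.                                                *)
Definition Maurer_Cartan (G : int -> set V) (l : forall k, ('I_k -> V) -> V)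
    (x : V) : Prop :=
  G 0 x /\ exists N, (forall k, (N <= k)%N -> l k (fun=> x) = 0) /\
    l 0%N (fun=> x) + \sum_(1 <= k < N) (k`!%:R)^-1 *: l k (fun=> x) = 0.

End Graded.

Section Gerstenhaber.
Variables (K : fieldType) (W : lmodType K).

(* With 0-based positions, the m.+1 arguments                                  *)
(*   x_0, ..., x_(i-1), g (x_i, ..., x_(i+n)), x_(i+n+1), ..., x_(m+n).        *)
Definition insert m n N (i : nat) (g : ('I_n.+1 -> W) -> W)
    (x : 'I_N.+1 -> W) : 'I_m.+1 -> W :=
  fun j => if (j < i)%N then x (inord j)
           else if j == i :> nat then g (fun k => x (inord (i + k)%N))
           else x (inord (j + n)%N).

(* The composition f o g, for N = m + n. As f and g have arity m + 1 and       *)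
(* n + 1, the sign (-1)^((i-1)(arity g - 1)) is (-1)^(i n) for 0-based i.      *)
Definition circ_fun m n N (f : ('I_m.+1 -> W) -> W) (g : ('I_n.+1 -> W) -> W)
    (x : 'I_N.+1 -> W) : W :=
  \sum_(i < m.+1) (-1) ^+ (i * n)%N *: f (insert i g x).

Fact circ_subproof m n N (e : N = (m + n)%N)
  (f : hom m.+1 W W) (g : hom n.+1 W W) :
  multilinear (@circ_fun m n N f g).
Proof.
move=> x p a u v; rewrite /circ_fun scaler_sumr -big_split /=.
apply: eq_bigr => i _; rewrite scalerA (mulrC a) -scalerA -scalerDr.
congr (_ *: _).
have ltN k (w : W) y : (k <= m + n)%N ->
    upd y p w (inord k) = if k == p :> nat then w else y (inord k).
  by move=> kP; rewrite /upd -val_eqE /= inordK // e ltnS.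
have pN : (p <= m + n)%N by rewrite -e leq_ord.
have im := leq_ord i.
have [pi|ip] := ltnP p i.
  have pm : (p < m.+1)%N by lia.
  have E w : insert i g (upd x p w) = upd (insert i g x) (Ordinal pm) w.
    apply: funext => j; have jm := leq_ord j.
    rewrite /insert [RHS]/upd -[j == _]val_eqE /=.
    have [ji|ij] := ltnP j i; first by rewrite ltN //; lia.
    rewrite [RHS]ifN; last by lia.
    case: eqP => ji.
      congr (hom_fun g _); apply: funext => k; have kn := leq_ord k.
      by rewrite ltN ?ifN //; lia.
    by rewrite ltN ?ifN //; lia.
  by rewrite !E hom_multilinear.
have [pin|ipn] := leqP p (i + n).
  have pin' : (p - i < n.+1)%N by lia.
  have E w : insert i g (upd x p w) = upd (insert i g x : 'I_m.+1 -> W) i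
     (g (upd (fun k => x (inord (i + k)%N)) (Ordinal pin') w)).
    apply: funext => j; have jm := leq_ord j.
    rewrite /insert [RHS]/upd -[j == i]val_eqE /=.
    have [ji|ij] := ltnP j i; first by rewrite ltN ?ifN //; lia.
    case: eqP => ji.
      congr (hom_fun g _); apply: funext => k; have kn := leq_ord k.
      rewrite ltN; last by lia.
      by rewrite /upd -val_eqE /=; congr (if _ then _ else _); lia.
    by rewrite ltN ?ifN //; lia.
  by rewrite !E !hom_multilinear.
have pn : (p - n < m.+1)%N by lia.
have E w : insert i g (upd x p w) = upd (insert i g x) (Ordinal pn) w.
  apply: funext => j; have jm := leq_ord j.
  rewrite /insert [RHS]/upd -[j == Ordinal _]val_eqE /=.
  have [ji|ij] := ltnP j i; first by rewrite ltN ?ifN ?[RHS]ifN //; lia.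
  case: eqP => ji.
    rewrite [RHS]ifN; last by lia.
    congr (hom_fun g _); apply: funext => k; have kn := leq_ord k.
    by rewrite ltN ?ifN //; lia.
  by rewrite ltN; [congr (if _ then _ else _); lia | lia].
by rewrite !E hom_multilinear.
Qed.

Definition circ m n N (e : N = (m + n)%N) (f : hom m.+1 W W)
  (g : hom n.+1 W W) : hom N.+1 W W := mkhom (circ_subproof e f g).

(* The Gerstenhaber bracket of f of degree m and g of degree n.                *)
Definition gbr m n N (e : N = (m + n)%N) (f : hom m.+1 W W)
    (g : hom n.+1 W W) : hom N.+1 W W :=
  circ e f g - (-1) ^+ (m * n)%N *: circ (etrans e (addnC m n)) g f.

Definition Gerst_fun (x y : cochains W W) N : hom N.+1 W W :=
  \sum_(i < N.+1) gbr (esym (subnKC (leq_ord i))) (x i) (y (N - i)%N).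

Lemma circ0l m n N (e : N = (m + n)%N) (g : hom n.+1 W W) :
  circ e (0 : hom m.+1 W W) g = 0.
Proof. by apply: homE => x; apply: big1 => i _; rewrite scaler0. Qed.

Lemma circ0r m n N (e : N = (m + n)%N) (f : hom m.+1 W W) :
  circ e f (0 : hom n.+1 W W) = 0.
Proof.
apply: homE => x; apply: big1 => i _; rewrite (@hom_zero _ _ _ _ _ _ i) ?scaler0 //.
by rewrite /insert ltnn eqxx.
Qed.
Fact Gerst_subproof (x y : cochains W W) :
  exists N, forall n, (N <= n)%N -> Gerst_fun x y n = 0.
Proof.
have [[N xN] [M yM]] := (dsum_finite x, dsum_finite y).
exists (N + M)%N => n nNM; apply: big1 => i _; rewrite /gbr.
have [Ni|iN] := leqP N i.
  by rewrite xN // circ0l circ0r scaler0 subrr.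
have in_ := leq_ord i; have yi : y (n - i)%N = 0 by apply: yM; lia.
by rewrite yi circ0l circ0r scaler0 subrr.
Qed.
Definition Gerst (x y : cochains W W) : cochains W W :=
  DSum (Gerst_subproof x y).

End Gerstenhaber.

Section Lift.
Variables (K : fieldType) (A A' : lmodType K).
Notation W := (A * A')%type.

Definition inA (x : A) : W := (x, 0).
Definition inA' (u : A') : W := (0, u).

Fact inA_linear : linear inA.
Proof. by move=> a x y; congr pair; rewrite /= scaler0 addr0. Qed.
HB.instance Definition _ := GRing.isLinear.Build K A W *:%R inA inA_linear.

Fact inA'_linear : linear inA'.
Proof. by move=> a x y; congr pair; rewrite /= scaler0 addr0. Qed.
HB.instance Definition _ := GRing.isLinear.Build K A' W *:%R inA' inA'_linear.

Lemma comp_upd n (U V : Type) (h : U -> V) (x : 'I_n -> U) i u :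
  h \o upd x i u = upd (h \o x) i (h u).
Proof. by apply: funext => j; rewrite /upd /=; case: ifP. Qed.

Fact lift_subproof n (f : hom n A A') :
  multilinear (fun x : 'I_n -> W => inA' (f (fst \o x))).
Proof.
by move=> x i a u v; rewrite !comp_upd linearP hom_multilinear linearP.
Qed.
Definition lift_hom n (f : hom n A A') : hom n W W := mkhom (lift_subproof f).

Fact lift_linear n : linear (@lift_hom n).
Proof. by move=> a f g; apply: homE => x; rewrite /= linearP. Qed.
HB.instance Definition _ n :=
  GRing.isLinear.Build K (hom n A A') (hom n W W) *:%R _ (@lift_linear n).

(* The Hom(A^{(x) n}, A') component of an element of Hom(W^{(x) n}, W). *)
Fact res_subproof n (f : hom n W W) :
  multilinear (fun x : 'I_n -> A => (f (inA \o x)).2).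
Proof. by move=> x i a u v; rewrite !comp_upd linearP hom_multilinear. Qed.
Definition res_hom n (f : hom n W W) : hom n A A' := mkhom (res_subproof f).

Fact res_linear n : linear (@res_hom n).
Proof. by move=> a f g; apply: homE. Qed.
HB.instance Definition _ n :=
  GRing.isLinear.Build K (hom n W W) (hom n A A') *:%R _ (@res_linear n).

Definition clift : cochains A A' -> cochains W W :=
  dsum_map (fun n => @lift_hom n.+1).

Definition cres : cochains W W -> cochains A A' :=
  dsum_map (fun n => @res_hom n.+1).

(* The projection onto the components Hom(A^{(x) n+1}, A') along all others. *)
Definition projF (x : cochains W W) : cochains W W := clift (cres x).

Lemma cliftK : cancel clift cres.
Proof. by move=> x; apply: dsumE => n; apply: homE. Qed.

(* A bilinear map X x Y -> Z between summands X, Y, Z of W, extended by zero,  *)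
(* where p and q are the projections of W onto X and Y and r is the inclusion  *)
(* of Z.                                                                       *)
Section Lift2.
Variables (X Y Z : lmodType K) (p : {linear W -> X}) (q : {linear W -> Y}).
Variables (r : {linear Z -> W}) (b : {bilinear X -> Y -> Z}).

Fact lift2_subproof :
  multilinear (fun x : 'I_2 -> W => r (b (p (x ord0)) (q (x ord_max)))).
Proof.
move=> x i a u v; rewrite /upd.
have [->|] := eqVneq i ord0; first by rewrite /= !linearP linearPl /= linearP.
move=> i0; have -> : i = ord_max by apply: val_inj; case: i i0 => [[|[|[]]]].
by rewrite /= !linearP.
Qed.
Definition lift2 : hom 2 W W := mkhom lift2_subproof.

End Lift2.

Fact hom1_subproof (D : {linear A -> A'}) :
  multilinear (fun x : 'I_1 -> A => D (x ord0)).
Proof. by move=> x i a u v; rewrite /upd (ord1 i) eqxx linearP. Qed.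
Definition hom1 (D : {linear A -> A'}) : hom 1 A A' := mkhom (hom1_subproof D).

End Lift.

Arguments inA {K A A'} x.
Arguments inA' {K A A'} u.

Section Component.
Variables (K : fieldType) (W X Y Z : lmodType K).
Variables (i : {linear X -> W}) (j : {linear Y -> W}) (p : {linear W -> Z}).
Variable m : {bilinear W -> W -> W}.

Definition component (x : X) (y : Y) : Z := p (m (i x) (j y)).

Fact component_bilinear : bilinear_for *:%R *:%R component.
Proof.
by split=> [y|x] a u v; rewrite /component !linearP ?linearPl /= ?linearP.
Qed.
HB.instance Definition _ :=
  bilinear_isBilinear.Build K X Y Z *:%R *:%R component component_bilinear.

End Component.

(* The decomposition is taken to be the external one: the algebra is A * A'.   *)
Record quasi_twilled (K : fieldType) (A A' : lmodType K) := QuasiTwilled {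
  qt_mul : {bilinear (A * A')%type -> (A * A')%type -> (A * A')%type};
  qt_assoc : associative qt_mul;
  qt_subalgebra : forall u v : A', (qt_mul (inA' u) (inA' v)).1 = 0 }.

Section QuasiTwilled.
Variables (K : fieldType) (A A' : lmodType K) (Q : quasi_twilled A A').
Notation W := (A * A')%type.
Notation Omega := (qt_mul Q).

Definition qt_pi : {bilinear A -> A -> A} := component inA inA fst Omega.
Definition qt_xi : {bilinear A -> A' -> A} := component inA inA' fst Omega.
Definition qt_eta : {bilinear A' -> A -> A} := component inA' inA fst Omega.
Definition qt_beta : {bilinear A' -> A' -> A'} :=
  component inA' inA' snd Omega.
Definition qt_rho : {bilinear A -> A' -> A'} := component inA inA' snd Omega.
Definition qt_mu : {bilinear A' -> A -> A'} := component inA' inA snd Omega.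
Definition qt_theta : {bilinear A -> A -> A'} := component inA inA snd Omega.

Lemma qt_mulE (x y : A) (u v : A') :
  Omega (x, u) (y, v) =
    (qt_pi x y + qt_xi x v + qt_eta u y,
     qt_beta u v + qt_rho x v + qt_mu u y + qt_theta x y).
Proof.
have E z w : (z, w) = inA z + inA' w :> W by congr pair; rewrite /= ?addr0 ?add0r.
rewrite (E x) (E y) linearDl /= !linearD [LHS]surjective_pairing /=.
rewrite qt_subalgebra addr0 !addrA; congr pair.
by rewrite addrC -!addrA; congr (_ + _); rewrite addrC -addrA.
Qed.

(* The seven components, as elements of degree 1 of the Gerstenhaber algebra. *)
Definition lpi : hom 2 W W := lift2 fst fst inA qt_pi.
Definition lxi : hom 2 W W := lift2 fst snd inA qt_xi.
Definition leta : hom 2 W W := lift2 snd fst inA qt_eta.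
Definition lbeta : hom 2 W W := lift2 snd snd inA' qt_beta.
Definition lrho : hom 2 W W := lift2 fst snd inA' qt_rho.
Definition lmu : hom 2 W W := lift2 snd fst inA' qt_mu.
Definition ltheta : hom 2 W W := lift2 fst fst inA' qt_theta.

Lemma qt_mul_lift (x : 'I_2 -> W) :
  (lpi + lxi + leta + lbeta + lrho + lmu + ltheta) x =
  Omega (x ord0) (x ord_max).
Proof.
rewrite [x ord0]surjective_pairing [x ord_max]surjective_pairing qt_mulE /=.
by congr pair; rewrite /= ?addr0 ?add0r.
Qed.

Definition right_deformation_map (D : {linear A -> A'}) : Prop :=
  forall x y : A,
    D (qt_pi x y + qt_xi x (D y) + qt_eta (D x) y) =
    qt_rho x (D y) + qt_mu (D x) y + qt_beta (D x) (D y) + qt_theta x y.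

End QuasiTwilled.

(* Main.v *)
Require Import Defs.
From HB Require Import structures.
From mathcomp Require Import all_boot all_order all_fingroup all_algebra.
From mathcomp Require Import zify ring.
From mathcomp Require Import boolp classical_sets functions.

Set Implicit Arguments.
Unset Strict Implicit.
Unset Printing Implicit Defensive.

Import Defs GRing.Theory.
Local Open Scope ring_scope.
Local Open Scope classical_set_scope.

(** The multiplication of [W = A * A'] is a square-zero element [Delta] of degree 1
    of the Gerstenhaber algebra of [W], and the curved L-infinity structure comes
    from its derived brackets with the abelian subalgebra of cochains on [A] with
    values in [A'].

    That the Gerstenhaber bracket is a graded Lie bracket follows from the pre-Lie
    identity [seq_circ_assoc]: the associator [(f o g) o h - f o (g o h)] is the
    sum of the terms in which [g] and [h] are plugged into disjoint places of [f],
    and this sum is graded symmetric in [g] and [h].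

    Everything else is governed by a weight. The bracket with the projection of
    [W] onto [A'], a cochain of degree 0, is a derivation that acts on the
    component of [Hom (W ^ n, W)] with [q] arguments in [A'] by the scalar [- q]
    or [1 - q], as the values lie in [A] or [A']. Weights add up under the
    bracket. In characteristic 0, no nonzero cochain has weight 2
    ([weight2_eq0]), and those of weight 1 are the lifts of the maps from powers of
    [A] to [A'] ([weight1_projF]). The subalgebra [F] is therefore abelian. As
    [A'] is a subalgebra, [Delta] has only parts of weight 1 ([theta]), 0
    ([pi + rho + mu]) and -1 ([xi + eta + beta]). So [theta],
    [[pi + rho + mu, f]] and [[[xi + eta + beta, f], g]] have weight 1 and lie in
    [F], for [f] and [g] in [F]. The equation [[Delta, Delta] = 0], which is the
    associativity of the product, splits by weight into four equations
    ([Delta_components]).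

    These four equations and the graded Jacobi identity give the relations of a
    curved L-infinity algebra, only those with at most three arguments being
    nontrivial ([derived_brackets_Linfty]). The Maurer-Cartan equation, evaluated
    on two elements of [A], is the equation of a right deformation map
    ([right_deformationE]). *)

(** * Linear identities in a module, decided in a commutative ring *)

(** Identities between linear combinations of vectors of [V] are decided by
    [ring] in the square-zero extension of [K] by [V]: the scalars and the
    vectors embed there, and scaling becomes a product. *)
Section SquareZero.
Variables (K : fieldType) (V : lmodType K).

Definition sqzero : Type := (K * V)%type.
HB.instance Definition _ := GRing.Zmodule.on sqzero.

Definition sqz_mul (x y : sqzero) : sqzero :=
  (x.1 * y.1, x.1 *: y.2 + y.1 *: x.2).

Fact sqz_mulA : associative sqz_mul.
Proof.
move=> [a u] [b v] [c w]; congr pair; rewrite /= ?mulrA //.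
by rewrite !scalerDr !scalerA addrA (mulrC c a) (mulrC b c) (mulrC c b).
Qed.
Fact sqz_mulC : commutative sqz_mul.
Proof. by move=> x y; congr pair; [apply: mulrC | apply: addrC]. Qed.
Fact sqz_mul1 : left_id ((1, 0) : sqzero) sqz_mul.
Proof.
by move=> [a u]; congr pair; rewrite /= ?mul1r // scale1r scaler0 addr0.
Qed.
Fact sqz_mulDl : left_distributive sqz_mul +%R.
Proof.
move=> [a u] [b v] [c w]; congr pair; rewrite /= ?mulrDl //.
by rewrite scalerDl scalerDr addrACA.
Qed.
Fact sqz_oner_neq0 : ((1, 0) : sqzero) != 0.
Proof. by apply/eqP => -[/eqP]; rewrite oner_eq0. Qed.

HB.instance Definition _ := GRing.Zmodule_isComNzRing.Build sqzero
  sqz_mulA sqz_mulC sqz_mul1 sqz_mulDl sqz_oner_neq0.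

Definition sqz_vec (v : V) : sqzero := (0, v).
Definition sqz_cst (a : K) : sqzero := (a, 0).

Fact sqz_cst_additive : {morph sqz_cst : u v / u - v}.
Proof. by move=> u v; congr pair; rewrite /= subr0. Qed.
HB.instance Definition _ := GRing.isZmodMorphism.Build K sqzero sqz_cst
  sqz_cst_additive.
Fact sqz_cst_multiplicative : monoid_morphism sqz_cst.
Proof. by split=> // a b; congr pair; rewrite /= !scaler0 addr0. Qed.
HB.instance Definition _ := GRing.isMonoidMorphism.Build K sqzero sqz_cst
  sqz_cst_multiplicative.

Lemma sqz_vec0 : sqz_vec 0 = 0.
Proof. by []. Qed.
Lemma sqz_vecD u v : sqz_vec (u + v) = sqz_vec u + sqz_vec v.
Proof. by congr pair; rewrite /= addr0. Qed.
Lemma sqz_vecN u : sqz_vec (- u) = - sqz_vec u.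
Proof. by congr pair; rewrite /= oppr0. Qed.
Lemma sqz_vecZ a v : sqz_vec (a *: v) = sqz_cst a * sqz_vec v.
Proof. by congr pair; rewrite /= ?mulr0 // scaler0 addr0. Qed.

Lemma sqz_vec_inj : injective sqz_vec.
Proof. by move=> u v []. Qed.

End SquareZero.

(** Transports an equality of vectors to the square-zero extension, for [ring] to
    close. *)
Ltac sqzero := apply: sqz_vec_inj;
  rewrite ?(sqz_vec0, sqz_vecD, sqz_vecN, sqz_vecZ, mulr2n).

(** * Insertions and the pre-Lie identity *)

Section Insertions.
Variables (K : fieldType) (W : lmodType K).
Implicit Types (s t : nat -> W) (F G H : (nat -> W) -> W).

(** The argument list in which [u] replaces the [n + 1] entries of [s] from
    position [i] on. Argument lists are infinite sequences, of which an operation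
    of arity [n + 1] reads the first [n + 1] entries: the arities of composites
    then need no transport along equalities of natural numbers. *)
Definition slot i n (u : W) s : nat -> W :=
  fun j => if (j < i)%N then s j else if j == i then u else s (j + n)%N.

Definition plug i n G s : nat -> W := slot i n (G (fun k => s (i + k)%N)) s.

Definition supported n G :=
  forall s t, (forall k, (k <= n)%N -> s k = t k) -> G s = G t.

Definition slot_linear m F :=
  forall i n s, (i <= m)%N -> linear (fun u => F (slot i n u s)).

Definition seq_circ m n F G s : W :=
  \sum_(0 <= i < m.+1) (-1) ^+ (i * n)%N *: F (plug i n G s).

(** Plugging at two disjoint places can be done in either order. Plugging [H]
    shortens the list by [p] entries, so what is at position [i] after it, to
    its right, was at position [i + p] before it. *)
Lemma plug_comm i j n p G H s : supported p H -> (j < i)%N ->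
  plug i n G (plug j p H s) = plug j p H (plug (i + p) n G s).
Proof.
move=> Hp ji; apply: funext => k; rewrite /plug /slot.
have [ki|ik] := ltnP k i.
  have [kj|jk] := ltnP k j; first by rewrite ifT //; lia.
  case: eqP => [_|kj].
    by apply: Hp => l lp; rewrite ifT //; lia.
  by rewrite ifT //; lia.
have [ki|ki] := eqVneq k i.
  do 3![rewrite ifF; last by lia]; rewrite ifT; last by lia.
  congr G; apply: funext => l; rewrite ifF; last by lia.
  by rewrite ifF; [congr s; lia|lia].
do 5![rewrite ifF; last by lia].
by rewrite ifF; [congr s; lia|lia].
Qed.

(** [H] lands inside the block of arguments that [G] consumes, so [G] and [H]
    first compose into a single operation of arity [n + p + 1]. *)
Lemma plug_nested i j n p G H s : (i <= j)%N -> (j <= i + n)%N ->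
  plug i n G (plug j p H s) =
  plug i (n + p) (fun t => G (plug (j - i) p H t)) s.
Proof.
move=> ij jin; apply: funext => k; rewrite /plug /slot.
have [ki|ik] := ltnP k i; first by rewrite ifT //; lia.
case: eqP => [ki|ki].
  congr G; apply: funext => l.
  have -> : (l < j - i)%N = (i + l < j)%N by lia.
  have -> : (l == j - i)%N = (i + l == j)%N by lia.
  rewrite addnA; do 2![case: ifP => // _].
  by congr H; apply: funext => q; congr s; lia.
rewrite ifF; last by lia.
by rewrite ifF; [congr s; lia|lia].
Qed.

(** The summands of [(F o G) o H] in which [H] is plugged into [F], to the left
    of [G]. *)
Definition disjoint_sum m n p F G H s : W :=
  \sum_(0 <= i < m.+1) \sum_(0 <= j < i)
    (-1) ^+ (j * p + i * n)%N *: F (plug i n G (plug j p H s)).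

Lemma slot_linear_sum m F i n s (r : seq nat) (c : nat -> K) (u : nat -> W) :
  slot_linear m F -> (i <= m)%N ->
  F (slot i n (\sum_(k <- r) c k *: u k) s) =
  \sum_(k <- r) c k *: F (slot i n (u k) s).
Proof.
move=> Fl im; have L := Fl i n s im; elim: r => [|k r IH].
  by rewrite !big_nil -{2}(subrr (F (slot i n 0 s))) -[in LHS](addNr 0)
    -scaleN1r L scaleN1r addNr subrr.
by rewrite !big_cons L IH.
Qed.

(** The associator of the composition. In [(F o G) o H] the operation [H] is
    plugged to the left of [G], inside [G], or to the right of [G]. The middle
    terms make up [F o (G o H)]; the other two families are exchanged, up to the
    sign [(-1) ^ (n p)], by exchanging [G] and [H]. Hence the associator is
    graded symmetric in its last two arguments: the pre-Lie identity. *)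
Lemma seq_circ_assoc m n p F G H s :
  slot_linear m F -> supported n G -> supported p H ->
  seq_circ (m + n) p (seq_circ m n F G) H s =
  seq_circ m (n + p) F (seq_circ n p G H) s
  + (disjoint_sum m n p F G H s
     + (-1) ^+ (n * p)%N *: disjoint_sum m p n F H G s).
Proof.
move=> Fl Gn Hp; rewrite /seq_circ.
pose T i j := (-1) ^+ (j * p + i * n)%N *: F (plug i n G (plug j p H s)).
transitivity (\sum_(0 <= i < m.+1) \sum_(0 <= j < (m + n).+1) T i j).
  rewrite exchange_big_nat /=; apply: eq_bigr => j _; rewrite scaler_sumr.
  by apply: eq_bigr => i _; rewrite scalerA -exprD.
have split3 i : (0 <= i < m.+1)%N -> \sum_(0 <= j < (m + n).+1) T i j =
    \sum_(0 <= j < i) T i j + (\sum_(i <= j < (i + n).+1) T i j +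
    \sum_((i + n).+1 <= j < (m + n).+1) T i j).
  by move=> im; rewrite -big_cat_nat -?big_cat_nat //=; lia.
rewrite (eq_big_nat _ _ split3) !big_split /= addrCA; congr (_ + _).
  apply: eq_big_nat => i im; rewrite [plug i (n + p) _ s]/plug.
  rewrite (slot_linear_sum _ _ _ _ _ Fl) /=; last by lia.
  rewrite scaler_sumr -{1}[i]add0n big_addn subSn ?leq_addr // addKn.
  apply: eq_big_nat => j jn; rewrite /T scalerA -exprD plug_nested; try lia.
  by rewrite addnK; congr (_ ^+ _ *: _); lia.
(* The terms in which [H] is to the right of [G]: shifting its position by the
   [n] extra arguments of [G] turns them into plugs of [G] to the left of [H]. *)
congr (_ + _); rewrite /disjoint_sum scaler_sumr.
transitivity (\sum_(0 <= i < m.+1) \sum_(i.+1 <= j < m.+1) T i (j + n)%N).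
  apply: eq_big_nat => i im; rewrite -addSn big_addn.
  by rewrite -addSn addnK.
under eq_bigr do rewrite (@big_nat_widenl _ _ _ _ 0) //=.
rewrite (@exchange_big_dep_nat _ _ _ _ _ _ _ _ _ xpredT) //=.
apply: eq_big_nat => j /andP[_ jm]; rewrite scaler_sumr.
rewrite [RHS](big_nat_widen _ _ m.+1) /=; last by lia.
rewrite big_nat_cond [RHS]big_nat_cond; apply: eq_bigr => i /andP[_ ij].
rewrite /T scalerA -exprD -(plug_comm _ _ _ Gn) //.
by congr (_ ^+ _ *: _); lia.
Qed.

Definition seq_br m n F G s : W :=
  seq_circ m n F G s - (-1) ^+ (m * n)%N *: seq_circ n m G F s.

Lemma seq_circ_linr m n F G H c s : slot_linear m F ->
  seq_circ m n F (fun t => G t - c *: H t) s =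
  seq_circ m n F G s - c *: seq_circ m n F H s.
Proof.
move=> Fl; rewrite /seq_circ scaler_sumr -sumrB; apply: eq_big_nat => i im.
rewrite /plug addrC -scaleNr Fl; last by lia.
by sqzero; ring.
Qed.

Lemma seq_circ_linl m n F G H c s :
  seq_circ m n (fun t => F t - c *: G t) H s =
  seq_circ m n F H s - c *: seq_circ m n G H s.
Proof.
rewrite /seq_circ scaler_sumr -sumrB; apply: eq_bigr => i _.
by sqzero; ring.
Qed.

(** The Jacobi identity is the alternating sum of the pre-Lie identity over the
    permutations of the three operations: the nested composites cancel directly,
    and the disjoint sums cancel by their symmetry. *)
Lemma seq_jacobi m n p F G H s :
  slot_linear m F -> slot_linear n G -> slot_linear p H ->
  supported m F -> supported n G -> supported p H ->
  seq_br m (n + p) F (seq_br n p G H) s =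
  seq_br (m + n) p (seq_br m n F G) H s
  + (-1) ^+ (m * n)%N *: seq_br n (m + p) G (seq_br m p F H) s.
Proof.
move=> Fl Gl Hl Fs Gs Hs; rewrite /seq_br !seq_circ_linr // !seq_circ_linl.
rewrite (seq_circ_assoc s Fl Gs Hs) (seq_circ_assoc s Gl Hs Fs).
rewrite (addnC m n) (seq_circ_assoc s Gl Fs Hs).
rewrite (addnC n p) (seq_circ_assoc s Hl Gs Fs).
rewrite (addnC m p) (seq_circ_assoc s Hl Fs Gs).
rewrite -(addnC m p) (seq_circ_assoc s Fl Hs Gs).
rewrite ?(addnC p m, addnC n m, addnC p n, mulnC p m, mulnC n m, mulnC p n).
rewrite !mulnDl !mulnDr !exprD ?(mulnC p m, mulnC n m, mulnC p n).
rewrite -(signr_odd _ (m * n)) -(signr_odd _ (m * p)) -(signr_odd _ (n * p)).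
by do 3![case: (odd _)]; rewrite ?expr0 ?expr1; sqzero; ring.
Qed.

End Insertions.

(** * The grading of a direct sum *)

Section DirectSumGrading.
Variables (K : fieldType) (V : nat -> lmodType K).
Implicit Types x y : dsum V.

Lemma dsum_addE x y n : (x + y) n = x n + y n. Proof. by []. Qed.

Lemma dsum_scaleE a x n : (a *: x) n = a *: x n. Proof. by []. Qed.

Lemma dsum_sumE (I : Type) (r : seq I) (c : I -> dsum V) n :
  (\sum_(i <- r) c i) n = \sum_(i <- r) c i n.
Proof. by elim/big_rec2: _ => // i y x _ <-. Qed.

Lemma dsum_in_linear n : linear (@dsum_in K V n).
Proof.
move=> a u v; apply: dsumE => k; rewrite dsum_addE dsum_scaleE.
have [<-|nk] := eqVneq n k; first by rewrite !dsum_in_eq.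
by rewrite !dsum_in_neq // scaler0 addr0.
Qed.
HB.instance Definition _ n := GRing.isLinear.Build K (V n) (dsum V) *:%R
  (@dsum_in K V n) (@dsum_in_linear n).

Lemma dsum_deg_in n (v : V n) : dsum_deg n%:Z (dsum_in v).
Proof.
by move=> k kn; rewrite dsum_in_neq //; apply: contra_neq kn => ->.
Qed.

Lemma dsum_deg_eq n x : dsum_deg n%:Z x -> x = dsum_in (x n).
Proof.
move=> xn; apply: dsumE => k; have [<-|nk] := eqVneq n k.
  by rewrite dsum_in_eq.
by rewrite dsum_in_neq // xn //; apply: contra_neq nk => -[].
Qed.

Lemma dsum_deg_neg n x : dsum_deg (Negz n) x -> x = 0.
Proof. by move=> xn; apply: dsumE => k; apply: xn. Qed.

Lemma dsum_deg_subspace i : subspace (@dsum_deg K V i).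
Proof.
split=> [n //|a u v ui vi n ni].
by rewrite dsum_addE dsum_scaleE ui // vi // scaler0 addr0.
Qed.

(** Total on the integers, since a grading is indexed by all of them. *)
Definition dsum_part x (i : int) : dsum V :=
  if i is Posz n then dsum_in (x n) else 0.

Lemma dsum_part_deg x i : dsum_deg i (dsum_part x i).
Proof. by case: i => n //=; apply: dsum_deg_in. Qed.

Lemma dsum_part_sum x : exists s : seq int, x = \sum_(i <- s) dsum_part x i.
Proof.
have [N xN] := dsum_finite x; exists (map Posz (iota 0 N)).
apply: dsumE => k; rewrite dsum_sumE big_map.
have [kN|Nk] := ltnP k N.
  rewrite (bigD1_seq k) ?iota_uniq ?mem_iota // dsum_in_eq.
  by rewrite big1 => [|i ik]; [rewrite /= addr0 | rewrite dsum_in_neq].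
rewrite xN // big_seq big1 // => i; rewrite mem_iota => /andP[_ iN].
by rewrite dsum_in_neq //; lia.
Qed.

Lemma dsum_grading : grading (@dsum_deg K V).
Proof.
split=> [i|x|s c us cd c0 i si]; first exact: dsum_deg_subspace.
  have [s xs] := dsum_part_sum x; exists s, (dsum_part x).
  by split=> // i; apply: dsum_part_deg.
case: i => n in si *; last exact: dsum_deg_neg (cd _).
rewrite (dsum_deg_eq (cd n)).
have := congr1 (fun x : dsum V => x n) c0.
rewrite dsum_sumE (bigD1_seq n%:Z) //= big1 ?addr0 => [->|j jn].
  by rewrite linear0.
by apply: cd; rewrite eq_sym.
Qed.

Lemma dsum_graded_subspace (S : set (dsum V)) : subspace S ->
  (forall n x, S x -> S (dsum_in (x n))) -> graded_subspace (@dsum_deg K V) S.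
Proof.
move=> SS Sp; split=> // x Sx; have [s xs] := dsum_part_sum x.
exists s, (dsum_part x); split=> // i; split; first exact: dsum_part_deg.
by case: i => n /=; [apply: Sp | case: SS].
Qed.

End DirectSumGrading.

(** * The Gerstenhaber bracket is a graded Lie bracket *)

Section GerstenhaberLie.
Variables (K : fieldType) (W : lmodType K).

Definition seq_fun n (f : hom n.+1 W W) : (nat -> W) -> W :=
  fun s => f (fun k : 'I_n.+1 => s k).

Lemma seq_fun_inj n : injective (@seq_fun n).
Proof.
move=> f g fg; apply: homE => x.
have := congr1 (fun F => F (x \o inord)) fg; rewrite /seq_fun /=.
by have -> : (fun k : 'I_n.+1 => x (inord k)) = x
  by apply: funext => k; rewrite inord_val.
Qed.

Lemma seq_fun_supported n (f : hom n.+1 W W) : supported n (seq_fun f).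
Proof.
by move=> s t st; congr (hom_fun f _); apply: funext => k; rewrite st ?leq_ord.
Qed.

Lemma seq_fun_linear n (f : hom n.+1 W W) : slot_linear n (seq_fun f).
Proof.
move=> i p s; rewrite -ltnS => im a u v; pose j := Ordinal im.
have E w : (fun k : 'I_n.+1 => slot i p w s k) =
    upd (fun k : 'I_n.+1 => slot i p 0 s k) j w.
  apply: funext => k; rewrite /upd /slot -val_eqE /=.
  by case: ltngtP.
by rewrite /seq_fun (E (a *: u + v)) (E u) (E v) hom_multilinear.
Qed.

(** Reading a multilinear map on infinite sequences turns the composition of
    cochains into the composition of operations on sequences. *)
Lemma seq_fun_circ m n N (e : N = (m + n)%N) (f : hom m.+1 W W)
  (g : hom n.+1 W W) :
  seq_fun (circ e f g) = seq_circ m n (seq_fun f) (seq_fun g).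
Proof.
apply: funext => s; rewrite /seq_circ big_mkord; apply: eq_bigr => i _.
have im := leq_ord i.
congr (_ *: hom_fun f _); apply: funext => j; have jm := leq_ord j.
rewrite /insert /plug /slot.
case: ifP => ji; first by rewrite inordK //; lia.
case: ifP => ji'; last by rewrite inordK //; lia.
congr (hom_fun g _); apply: funext => k; have kn := leq_ord k.
by rewrite inordK //; lia.
Qed.

Lemma seq_fun_gbr m n N (e : N = (m + n)%N) (f : hom m.+1 W W)
  (g : hom n.+1 W W) :
  seq_fun (gbr e f g) = seq_br m n (seq_fun f) (seq_fun g).
Proof.
apply: funext => s.
by rewrite /seq_br -(seq_fun_circ e) -(seq_fun_circ (etrans e (addnC m n))).
Qed.

Lemma circ_linearl m n N (e : N = (m + n)%N) (g : hom n.+1 W W) :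
  linear (fun f : hom m.+1 W W => circ e f g).
Proof.
move=> a u v; apply: homE => x.
transitivity (a *: circ e u g x + circ e v g x) => //=.
rewrite /circ_fun scaler_sumr -big_split; apply: eq_bigr => i _.
transitivity ((-1) ^+ (i * n)%N *: (a *: u (insert i g x) + v (insert i g x))).
  by [].
by sqzero; ring.
Qed.

Lemma circ_linearr m n N (e : N = (m + n)%N) (f : hom m.+1 W W) :
  linear (fun g : hom n.+1 W W => circ e f g).
Proof.
move=> a u v; apply/seq_fun_inj/funext => s.
transitivity (a *: seq_fun (circ e f u) s + seq_fun (circ e f v) s) => //.
rewrite !seq_fun_circ /seq_circ scaler_sumr -big_split.
apply: eq_big_nat => i im; rewrite /plug.
transitivity ((-1) ^+ (i * n)%N *: seq_fun f (slot i n
  (a *: seq_fun u (fun k => s (i + k)%N) +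
   seq_fun v (fun k => s (i + k)%N)) s)) => //.
by rewrite seq_fun_linear; [sqzero; ring | lia].
Qed.

Lemma gbr_linearl m n N (e : N = (m + n)%N) (g : hom n.+1 W W) :
  linear (fun f : hom m.+1 W W => gbr e f g).
Proof.
by move=> a u v; rewrite /gbr circ_linearl circ_linearr; sqzero; ring.
Qed.

Lemma gbr_linearr m n N (e : N = (m + n)%N) (f : hom m.+1 W W) :
  linear (fun g : hom n.+1 W W => gbr e f g).
Proof.
by move=> a u v; rewrite /gbr circ_linearl circ_linearr; sqzero; ring.
Qed.

Lemma gbr_antisym m n N (e : N = (m + n)%N) (e' : N = (n + m)%N)
  (f : hom m.+1 W W) (g : hom n.+1 W W) :
  gbr e f g = - ((-1) ^+ (m * n) *: gbr e' g f).
Proof.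
apply/seq_fun_inj; rewrite seq_fun_gbr.
transitivity (fun s => - ((-1) ^+ (m * n) *: seq_fun (gbr e' g f) s)) => //.
rewrite seq_fun_gbr; apply: funext => s; rewrite /seq_br (mulnC n m).
by rewrite -signr_odd; case: odd; rewrite ?expr0 ?expr1; sqzero; ring.
Qed.

(** The arities of the inner brackets are variables, so that the three iterated
    brackets can be compared in one common arity. *)
Lemma gbr_jacobi m n p N M1 M2 M3 (f : hom m.+1 W W) (g : hom n.+1 W W)
  (h : hom p.+1 W W) (e1 : M1 = (n + p)%N) (e2 : M2 = (m + n)%N)
  (e3 : M3 = (m + p)%N) (d1 : N = (m + M1)%N) (d2 : N = (M2 + p)%N)
  (d3 : N = (n + M3)%N) :
  gbr d1 f (gbr e1 g h) =
  gbr d2 (gbr e2 f g) h + (-1) ^+ (m * n) *: gbr d3 g (gbr e3 f h).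
Proof.
apply/seq_fun_inj/funext => s.
transitivity (seq_fun (gbr d2 (gbr e2 f g) h) s
  + (-1) ^+ (m * n) *: seq_fun (gbr d3 g (gbr e3 f h)) s) => //.
rewrite !seq_fun_gbr; subst M1 M2 M3.
by apply: seq_jacobi; (apply: seq_fun_linear || apply: seq_fun_supported).
Qed.

(** For a product [f], [(f o f) (x, y, z) = (x y) z - x (y z)]. *)
Lemma circ_associative (e : 2 = (1 + 1)%N) (f : hom 2 W W) (m : W -> W -> W) :
  (forall x, f x = m (x ord0) (x ord_max)) -> associative m -> circ e f f = 0.
Proof.
move=> fE mA; apply: homE => w.
transitivity (circ_fun (N := 2) f f w) => //.
rewrite /circ_fun !big_ord_recl big_ord0 addr0 /= expr0 expr1 scale1r scaleN1r.
rewrite !fE /insert /= !fE mA.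
exact: subrr.
Qed.

(** The bracket with a linear endomorphism [g] is the defect of [g] from being a
    derivation of [f]. *)
Lemma gbr_degree0 n (e : n = (n + 0)%N) (f : hom n.+1 W W) (g : hom 1 W W)
    (w : 'I_n.+1 -> W) :
  gbr e f g w =
  \sum_(i < n.+1) f (upd w i (g (fun=> w i))) - g (fun=> f w).
Proof.
transitivity (circ_fun (N := n) f g w -
  (-1) ^+ (n * 0) *: circ_fun (N := n) g f w) => //.
rewrite /circ_fun big_ord1 muln0 mul0n expr0 !scale1r; congr (_ - _).
  apply: eq_bigr => i _; rewrite muln0 scale1r; congr (hom_fun f _).
  apply: funext => j; rewrite /insert /upd -val_eqE /=.
  case: ltngtP => _; rewrite ?addn0 ?inord_val //.
  by congr (hom_fun g _); apply: funext => k; rewrite ord1 addn0 inord_val.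
congr (hom_fun g _); apply: funext => k; rewrite (ord1 k) /insert /=.
by congr (hom_fun f _); apply: funext => j; rewrite inord_val.
Qed.

Lemma gbr0l m n N (e : N = (m + n)%N) (g : hom n.+1 W W) :
  gbr e (0 : hom m.+1 W W) g = 0.
Proof. by rewrite /gbr circ0l circ0r scaler0 subr0. Qed.

Lemma gbr0r m n N (e : N = (m + n)%N) (f : hom m.+1 W W) :
  gbr e f (0 : hom n.+1 W W) = 0.
Proof. by rewrite /gbr circ0l circ0r scaler0 subr0. Qed.

Lemma Gerst_linearl y : linear ((@Gerst K W)^~ y).
Proof.
move=> a u v; apply: dsumE => N; rewrite dsum_addE dsum_scaleE.
rewrite /= /Gerst_fun scaler_sumr -big_split; apply: eq_bigr => i _.
exact: gbr_linearl.
Qed.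

Lemma Gerst_linearr x : linear (@Gerst K W x).
Proof.
move=> a u v; apply: dsumE => N; rewrite dsum_addE dsum_scaleE.
rewrite /= /Gerst_fun scaler_sumr -big_split; apply: eq_bigr => i _.
exact: gbr_linearr.
Qed.

HB.instance Definition _ x := GRing.isLinear.Build K (cochains W W)
  (cochains W W) *:%R (@Gerst K W x) (Gerst_linearr x).

Lemma Gerst0l y : Gerst (0 : cochains W W) y = 0.
Proof.
by rewrite -[X in Gerst X](addNr 0) -scaleN1r Gerst_linearl scaleN1r addNr.
Qed.

Lemma Gerst_homE m n N (e : N = (m + n)%N) (f : hom m.+1 W W)
  (y : cochains W W) : Gerst (cochain_in f) y N = gbr e f (y n).
Proof.
have mN : (m < N.+1)%N by rewrite e ltnS leq_addr.
change (Gerst_fun (cochain_in f) y N = gbr e f (y n)).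
rewrite /Gerst_fun (bigD1 (Ordinal mN)) // big1 => [|i im].
  apply: etrans (addr0 _) _; have nE : n = (N - m)%N by rewrite e addKn.
  rewrite /cochain_in dsum_in_eq.
  have -> : esym (subnKC (leq_ord (Ordinal mN))) =
    etrans e (congr1 (addn m) nE) by apply: eq_irrelevance.
  by move: (etrans _ _); rewrite -nE => e'; rewrite (eq_irrelevance e' e).
rewrite /cochain_in dsum_in_neq ?gbr0l //.
by apply: contra_neq im => mi; apply: val_inj.
Qed.

Lemma Gerst_hom0 m N (f : hom m.+1 W W) (y : cochains W W) :
  (N < m)%N -> Gerst (cochain_in f) y N = 0.
Proof.
move=> Nm; apply: big1 => i _; rewrite /cochain_in dsum_in_neq ?gbr0l //.
by have := leq_ord i; lia.
Qed.

Lemma Gerst_in m n N (e : N = (m + n)%N) (f : hom m.+1 W W)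
    (g : hom n.+1 W W) :
  Gerst (cochain_in f) (cochain_in g) = cochain_in (gbr e f g).
Proof.
apply: dsumE => k; have [km|mk] := ltnP k m.
  by rewrite Gerst_hom0 // /cochain_in dsum_in_neq //; lia.
have ek : k = (m + (k - m))%N by rewrite subnKC.
rewrite (Gerst_homE ek); have [Nk|Nk] := eqVneq N k.
  subst k; rewrite {2}/cochain_in dsum_in_eq.
  have nE : n = (N - m)%N by rewrite e addKn.
  move: ek; rewrite -nE => ek; rewrite (eq_irrelevance ek e).
  by rewrite /cochain_in dsum_in_eq.
rewrite {1 2}/cochain_in [RHS]dsum_in_neq // dsum_in_neq ?gbr0r //; lia.
Qed.

Lemma cochain_deg_in n (f : hom n.+1 W W) : cochain_deg n%:Z (cochain_in f).
Proof. exact: dsum_deg_in. Qed.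

Lemma cochain_deg0 i : cochain_deg i (0 : cochains W W).
Proof. by []. Qed.

Lemma cochain_homogeneous i (x : cochains W W) : cochain_deg i x ->
  x = 0 \/ exists n (f : hom n.+1 W W), i = n%:Z /\ x = cochain_in f.
Proof.
case: i => n xn; last by left; apply: dsum_deg_neg xn.
by right; exists n, (x n); split=> //; apply: dsum_deg_eq.
Qed.

Theorem Gerst_graded_Lie : graded_Lie cochain_deg (@Gerst K W).
Proof.
split; [exact: dsum_grading | exact: Gerst_linearl | exact: Gerst_linearr |..].
- move=> i j x y /cochain_homogeneous[-> _|[m [f [-> ->]]]].
    by rewrite Gerst0l; apply: cochain_deg0.
  move=> /cochain_homogeneous[->|[n [g [-> ->]]]].
    by rewrite linear0; apply: cochain_deg0.
  by rewrite (Gerst_in erefl); apply: cochain_deg_in.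
- move=> i j x y /cochain_homogeneous[-> _|[m [f [-> ->]]]].
    by rewrite Gerst0l linear0 scaler0 oppr0.
  move=> /cochain_homogeneous[->|[n [g [-> ->]]]].
    by rewrite Gerst0l linear0 scaler0 oppr0.
  rewrite (Gerst_in erefl) (Gerst_in (addnC m n)) (gbr_antisym _ (addnC m n)).
  by rewrite /cochain_in linearN linearZ.
move=> i j k x y z /cochain_homogeneous[-> _ _|[m [f [-> ->]]]].
  by rewrite !Gerst0l linear0 scaler0 addr0.
move=> /cochain_homogeneous[-> _|[n [g [-> ->]]]].
  by rewrite !(Gerst0l, linear0) addr0.
move=> /cochain_homogeneous[->|[p [h [_ ->]]]].
  by rewrite !linear0 addr0.
rewrite (Gerst_in erefl g h) (Gerst_in erefl f g) (Gerst_in erefl f h).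
rewrite (Gerst_in (erefl (m + (n + p))%N)) (Gerst_in (addnA m n p)).
rewrite (Gerst_in (addnCA m n p)).
rewrite (gbr_jacobi _ _ _ erefl erefl erefl erefl (addnA m n p)
  (addnCA m n p)).
by rewrite /cochain_in linearD linearZ.
Qed.

End GerstenhaberLie.

(** * Weights: the bracket with the projection onto the second summand *)

Section Weights.
Variables (K : fieldType) (A A' : lmodType K).
Notation W := (A * A')%type.
Implicit Types (x y : cochains W W) (a b c : K).

Fact proj2_subproof : multilinear (fun w : 'I_1 -> W => inA' (w ord0).2 : W).
Proof. by move=> w i a u v; rewrite /upd (ord1 i) eqxx linearD linearZ. Qed.
Definition proj2 : hom 1 W W := mkhom proj2_subproof.

(** A component of [Hom (W ^ n, W)] with [q] arguments in [A'] and values in [A]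
    is an eigenvector of the bracket with the projection onto [A'], for the
    eigenvalue [- q]; if the values are in [A'], the eigenvalue is [1 - q]. The
    weights of cochains are these eigenvalues. The largest one, [1], is reached
    exactly on the components [Hom (A ^ n, A')]. *)
Definition weight c y := Gerst (cochain_in proj2) y = c *: y.

Lemma Gerst_proj2 y N (w : 'I_N.+1 -> W) :
  Gerst (cochain_in proj2) y N w =
  inA' (y N w).2 - \sum_(i < N.+1) y N (upd w i (inA' (w i).2)).
Proof.
rewrite (Gerst_homE (erefl : N = (0 + N)%N)).
rewrite (gbr_antisym _ (esym (addn0 N))) mul0n expr0 scale1r.
transitivity (- gbr (esym (addn0 N)) (y N) proj2 w) => //.
by rewrite gbr_degree0 opprB.
Qed.

Lemma weightD c x y : weight c x -> weight c y -> weight c (x + y).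
Proof. by move=> xc yc; rewrite /weight linearD /= xc yc scalerDr. Qed.

Lemma weightZ c a x : weight c x -> weight c (a *: x).
Proof. by move=> xc; rewrite /weight linearZ /= xc !scalerA mulrC. Qed.

Lemma GerstDl x y z : Gerst (x + y) z = Gerst x z + Gerst y z.
Proof. by have := Gerst_linearl z 1 x y; rewrite !scale1r. Qed.

Lemma GerstZl a x z : Gerst (a *: x) z = a *: Gerst x z.
Proof. by have := Gerst_linearl z a x 0; rewrite Gerst0l !addr0. Qed.

(** The projection has degree 0, so the Jacobi identity has no sign on
    homogeneous elements, and hence holds for all cochains. *)
Lemma Gerst_proj2_derivation x y :
  Gerst (cochain_in proj2) (Gerst x y) =
  Gerst (Gerst (cochain_in proj2) x) y + Gerst x (Gerst (cochain_in proj2) y).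
Proof.
have [[s ->] [t ->]] := (dsum_part_sum x, dsum_part_sum y).
elim/big_ind: _ => [|u v IHu IHv|i _].
- by rewrite !(Gerst0l, linear0) addr0.
- by rewrite !(GerstDl, linearD) /= IHu IHv addrACA.
elim/big_ind: _ => [|u v IHu IHv|j _].
- by rewrite !linear0 addr0.
- by rewrite !linearD /= IHu IHv addrACA.
rewrite (gLie_jacobi (Gerst_graded_Lie W) (cochain_deg_in proj2)
  (@dsum_part_deg _ _ x i : cochain_deg i _)
  (@dsum_part_deg _ _ y j : cochain_deg j _)).
by rewrite mul0r /ksign expr0z scale1r.
Qed.

Lemma weight_Gerst a b x y :
  weight a x -> weight b y -> weight (a + b) (Gerst x y).
Proof.
move=> xa yb; rewrite /weight Gerst_proj2_derivation xa yb GerstZl.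
by rewrite linearZ /= scalerDl.
Qed.

(** A multilinear map on a direct sum is determined by its values on lists of
    arguments that each lie in one summand. *)
Lemma hom_pure0 n (f : hom n W W) :
  (forall w, (forall i, (w i).1 = 0 \/ (w i).2 = 0) -> f w = 0) -> f = 0.
Proof.
move=> fP; apply: homE => w; apply: etrans (erefl (0 : W)).
(* Induction on the number [k] of leading arguments that are arbitrary. *)
have {fP} fP k : forall w, (forall i : 'I_n, (k <= i)%N ->
    (w i).1 = 0 \/ (w i).2 = 0) -> f w = 0.
  elim: k => [|k IH] {}w wk; first by apply: fP => i; apply: wk.
  have [kn|nk] := ltnP k n; last first.
    by apply: IH => i ki; move: (ltn_ord i); rewrite ltnNge (leq_trans nk ki).
  pose i := Ordinal kn.
  have -> : w = upd w i (1 *: inA (w i).1 + inA' (w i).2).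
    apply: funext => j; rewrite /upd; case: eqP => // ->.
    rewrite scale1r [LHS]surjective_pairing.
    by congr pair; rewrite /= ?addr0 ?add0r.
  rewrite hom_multilinear !IH ?scaler0 ?addr0 // => j kj; rewrite /upd.
    by case: eqVneq => [_|]; [left | rewrite -val_eqE /= => ji; apply: wk; lia].
  by case: eqVneq => [_|]; [right | rewrite -val_eqE /= => ji; apply: wk; lia].
by apply: (fP n) => i; rewrite leqNgt ltn_ord.
Qed.

(** The number of arguments in [A'], on lists whose entries lie in [A] or [A'].
    An entry [0] is counted, which does no harm: a multilinear map vanishes on
    such a list. *)
Definition arity2 n (w : 'I_n -> W) : nat :=
  (\sum_(i < n) ((w i).1 == 0%R))%N.

Lemma weight_pure c y N (w : 'I_N.+1 -> W) : weight c y ->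
  (forall i, (w i).1 = 0 \/ (w i).2 = 0) ->
  (c + (arity2 w)%:R) *: (y N w).1 = 0 /\
  (c + (arity2 w)%:R - 1) *: (y N w).2 = 0.
Proof.
move=> yc wP; have := congr1 (fun z : cochains W W => z N w) yc.
rewrite Gerst_proj2.
have -> : \sum_(i < N.+1) y N (upd w i (inA' (w i).2)) =
    (arity2 w)%:R *: y N w.
  rewrite natr_sum scaler_suml; apply: eq_bigr => i _.
  have [wi1|wi1] := eqVneq (w i).1 0.
    rewrite scale1r; congr (hom_fun _ _); apply: funext => j.
    rewrite /upd; case: eqP => // ->.
    by rewrite [RHS]surjective_pairing wi1.
  have wi2 : (w i).2 = 0 by case: (wP i) => // /eqP; rewrite (negPf wi1).
  by rewrite scale0r (@hom_zero _ _ _ _ _ _ i) // /upd eqxx wi2.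
set q := (arity2 w)%:R => Ev.
have {}Ev : inA' (y N w).2 - q *: y N w = c *: y N w by [].
move: (y N w) Ev => v Ev.
have E1 := congr1 fst Ev; have E2 := congr1 snd Ev; move: E1 E2 => /= E1 E2.
rewrite !(scalerDl, scaleNr, scale1r) -E1 -E2; split; sqzero; ring.
Qed.

(** In characteristic 0 neither [2 + q] nor [1 + q] vanishes, so no component has
    weight 2. *)
Lemma weight2_eq0 y : [pchar K] =i pred0 -> weight 2 y -> y = 0.
Proof.
move=> /pcharf0P K0 y2; apply: dsumE => n; apply: hom_pure0 => w wP.
have [/eqP + /eqP] := weight_pure y2 wP.
rewrite -natrD add2n -[in X in _ -> X]natr1 addrK !scaler_eq0 !K0 /=.
move=> /eqP y1 /eqP y2w.
by rewrite [LHS]surjective_pairing y1 y2w.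
Qed.

(** In characteristic 0, weight 1 forces the values to be in [A'], and vanishing
    as soon as one argument is in [A']. *)
Lemma weight1_projF y : [pchar K] =i pred0 -> weight 1 y -> projF y = y.
Proof.
move=> /pcharf0P K0 y1; apply: dsumE => n; apply/eqP; rewrite -subr_eq0.
apply/eqP/hom_pure0 => w wP.
transitivity (inA' (y n (inA \o (fst \o w))).2 - y n w) => //.
have [/eqP + /eqP] := weight_pure y1 wP.
rewrite [1 + _]addrC addrK natr1 !scaler_eq0 !K0 /= => /eqP y1w.
rewrite [y n w]surjective_pairing y1w.
case: (boolP [forall i, (w i).1 != 0]) => [/forallP w1 _|].
  have -> : inA \o (fst \o w) = w :> ('I_n.+1 -> W).
    apply: funext => i /=; rewrite [RHS]surjective_pairing; congr pair.
    by case: (wP i) (w1 i) => // ->; rewrite eqxx.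
  by rewrite subrr.
rewrite negb_forall => /existsP[i]; rewrite negbK => wi.
rewrite /arity2 (bigD1 i) //= wi => /eqP ->; rewrite subr0.
by rewrite (@hom_zero _ _ _ _ _ _ i) //= (eqP wi).
Qed.

Lemma projF_clift (f : cochains A A') : projF (clift f) = clift f.
Proof. by rewrite /projF cliftK. Qed.

(** The weight of an elementary binary component: [a], [b] and [c] are 1 or 0,
    according to whether the first source, the second source and the target are
    [A'] or [A]. *)
Lemma lift2_weight (X Y Z : lmodType K) (p : {linear W -> X})
    (q : {linear W -> Y}) (r : {linear Z -> W}) (m : {bilinear X -> Y -> Z})
    a b c :
  (forall w, p (inA' w.2) = a *: p w) -> (forall w, q (inA' w.2) = b *: q w) ->
  (forall z, inA' (r z).2 = c *: r z) ->
  weight (c - a - b) (cochain_in (lift2 p q r m)).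
Proof.
move=> pa qb rc; rewrite /weight (Gerst_in (erefl : 1 = (0 + 1)%N)).
rewrite /cochain_in -linearZ; congr dsum_in; apply: homE => w.
have := Gerst_proj2 (cochain_in (lift2 p q r m)) w.
rewrite (Gerst_homE (erefl : 1 = (0 + 1)%N)) /cochain_in dsum_in_eq => ->.
rewrite !big_ord_recl big_ord0 addr0 /= rc.
have -> : lift ord0 ord0 = ord_max :> 'I_2 by apply: val_inj.
rewrite /upd /= pa qb linearZl_LR !linearZ /=.
transitivity ((c - a - b) *: r (m (p (w ord0)) (q (w ord_max)))) => //.
by sqzero; ring.
Qed.

Lemma clift_weight (f : cochains A A') : weight 1 (clift f).
Proof.
apply: dsumE => n; apply: homE => w; rewrite Gerst_proj2 scale1r.
rewrite big1 ?subr0 // => i _.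
transitivity (inA' (f n (fst \o upd w i (inA' (w i).2))) : W) => //.
by rewrite (@hom_zero _ _ _ _ _ _ i) //= /upd eqxx.
Qed.

End Weights.

(** * Koszul signs and shuffles of at most three elements *)

Section KoszulSigns.
Variable K : fieldType.

(** Sign identities between products of [ksign] become boolean identities between
    parities, which are checked by cases. *)
Definition parity (i : int) : bool := odd `|i|%N.

Lemma parityD i k : parity (i + k) = parity i (+) parity k.
Proof.
by rewrite /parity; apply/idP/idP; lia.
Qed.

Lemma parityM i k : parity (i * k) = parity i && parity k.
Proof. by rewrite /parity abszM oddM. Qed.

Lemma ksignE i : ksign K i = (-1) ^+ parity i.
Proof.
rewrite /parity signr_odd; case: i => n //.
exact: invr_sign.
Qed.

End KoszulSigns.

Lemma koszul2 (K : fieldType) (d : 'I_2 -> int) (s : 'S_2) :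
  koszul K d s = if (s ord_max < s ord0)%N
                 then ksign K (d (s ord0) * d (s ord_max)) else 1.
Proof.
rewrite /koszul !big_ord_recl !big_ord0 !big_mkcond /=.
rewrite !big_ord_recl !big_ord0 !big_mkcond /=.
rewrite !big_ord_recl !big_ord0.
have -> : lift ord0 ord0 = ord_max :> 'I_2 by apply: val_inj.
by rewrite /= !mulr1 mul1r.
Qed.

Lemma koszul3 (K : fieldType) (d : 'I_3 -> int) (s : 'S_3) (a b c : 'I_3) :
 a = 0%N :> nat -> b = 1%N :> nat -> c = 2%N :> nat ->
  koszul K d s = (if (s b < s a)%N then ksign K (d (s a) * d (s b)) else 1) *
   (if (s c < s a)%N then ksign K (d (s a) * d (s c)) else 1) *
   (if (s c < s b)%N then ksign K (d (s b) * d (s c)) else 1).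
Proof.
move=> a0 b1 c2.
rewrite /koszul !big_ord_recl !big_ord0 !big_mkcond /=.
rewrite !big_ord_recl !big_ord0 !big_mkcond /=.
rewrite !big_ord_recl !big_ord0 !big_mkcond !big_ord_recl !big_ord0.
have -> : lift ord0 (lift ord0 ord0) = c by apply: val_inj.
have -> : lift ord0 ord0 = b by apply: val_inj.
have -> : ord0 = a by apply: val_inj.
by rewrite a0 b1 c2 /= !(mulr1, mul1r).
Qed.

(** The (2,1)-shuffles are the three permutations that keep the first two
    positions in order: the last one receives 2, 1 or 0. *)
Lemma shuffle_2_1 (U : nmodType) (F : 'S_3 -> U) (a b c : 'I_3) :
  a = 0%N :> nat -> b = 1%N :> nat -> c = 2%N :> nat ->
  \sum_(s : 'S_3 | shuffle 2 s) F s =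
  F 1%g + F (tperm b c) + F (tperm a b * tperm a c)%g.
Proof.
move=> a0 b1 c2.
have abc (i : 'I_3) : [\/ i = a, i = b | i = c].
  case: i => -[|[|[|//]]] ?; [apply: Or31|apply: Or32|apply: Or33];
    by apply: val_inj; rewrite /= ?a0 ?b1 ?c2.
have ab : a != b by rewrite -val_eqE /= a0 b1.
have ac : a != c by rewrite -val_eqE /= a0 c2.
have bc : b != c by rewrite -val_eqE /= b1 c2.
have permE3 (s t : 'S_3) : (s == t) = [&& s a == t a, s b == t b & s c == t c].
  apply/eqP/and3P => [->|[/eqP sa /eqP sb /eqP sc]]; first by rewrite !eqxx.
  by apply/permP => i; case: (abc i) => ->.
have shE (s : 'S_3) : shuffle 2 s = (s a < s b)%N.
  apply/forallP/idP => [/(_ a)/forallP/(_ b)|sab i]; first by rewrite a0 b1.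
  apply/forallP => k; apply/implyP.
  by case: (abc i) (abc k) => [] -> [] ->; rewrite ?a0 ?b1 ?c2.
pose t2 : 'S_3 := tperm b c; pose t3 : 'S_3 := (tperm a b * tperm a c)%g.
have t2E : [/\ t2 a = a, t2 b = c & t2 c = b].
  by rewrite /t2 tpermL tpermR tpermD // eq_sym.
have t3E : [/\ t3 a = b, t3 b = c & t3 c = a].
  have cb : c != b by rewrite eq_sym.
  by rewrite /t3 !permM !(tpermL, tpermR, tpermD ac bc, tpermD ab cb).
rewrite -/t2 -/t3; case: t2E t3E => t2a t2b t2c [t3a t3b t3c].
have sE : [pred s : 'S_3 | shuffle 2 s] =i [:: 1%g; t2; t3].
  move=> s; rewrite !inE shE !permE3 !perm1 t2a t2b t2c t3a t3b t3c.
  have sab : s a != s b by rewrite (inj_eq perm_inj).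
  have sac : s a != s c by rewrite (inj_eq perm_inj).
  have sbc : s b != s c by rewrite (inj_eq perm_inj).
  move: sab sac sbc.
  by case: (abc (s a)) (abc (s b)) (abc (s c)) => [] -> [] -> [] ->;
    rewrite -!val_eqE /= ?a0 ?b1 ?c2.
rewrite (eq_bigl (mem [:: 1%g; t2; t3])) => [|s]; last exact: (sE s).
rewrite -big_uniq /=; last first.
  rewrite !inE !negb_or !permE3 !perm1 t2a t2b t2c t3a t3b t3c.
  by rewrite -!val_eqE /= ?a0 ?b1 ?c2.
by rewrite !big_cons big_nil addr0 addrA.
Qed.

Lemma fcons0 (K : fieldType) (U : lmodType K) n (v : U) (x : 'I_n -> U) :
  fcons v x ord0 = v.
Proof. by rewrite /fcons unlift_none. Qed.

Lemma fcons_max (K : fieldType) (U : lmodType K) (v : U) (x : 'I_1 -> U) :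
  fcons v x ord_max = x ord0.
Proof.
have -> : ord_max = lift ord0 ord0 :> 'I_2 by apply: val_inj.
by rewrite /fcons liftK.
Qed.

Lemma sum_perm2 (U : nmodType) (P : pred 'S_2) (F : 'S_2 -> U) :
  \sum_(s | P s) F s =
  (if P 1%g then F 1%g else 0) +
  (if P (tperm ord0 ord_max) then F (tperm ord0 ord_max) else 0).
Proof.
pose t : 'S_2 := tperm ord0 ord_max.
have ord2 (i : 'I_2) : i = ord0 \/ i = ord_max.
  by case: i => -[|[|//]] ?; [left | right]; apply: val_inj.
have sE : predT =i [:: 1%g; t].
  move=> s; rewrite !inE; apply/esym; have [s0|s0] := ord2 (s ord0).
    apply/orP; left; apply/eqP/permP => i; rewrite perm1.
    have [->//|->] := ord2 i; have [sm|//] := ord2 (s ord_max).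
    by have := perm_inj (etrans s0 (esym sm)).
  apply/orP; right; apply/eqP/permP => i.
  have [->|->] := ord2 i; first by rewrite tpermL.
  rewrite tpermR; have [//|sm] := ord2 (s ord_max).
  by have := perm_inj (etrans s0 (esym sm)).
rewrite big_mkcond (eq_bigl (mem [:: 1%g; t])) => [|s]; last exact: (sE s).
rewrite -big_uniq /=; last first.
  rewrite inE andbT; apply/eqP => /(congr1 (fun s : 'S_2 => s ord0)).
  by rewrite perm1 tpermL.
by rewrite !big_cons big_nil addr0.
Qed.

Lemma shuffle1 n i : shuffle i (1%g : 'S_n).
Proof.
apply/forallP => a; apply/forallP => b; rewrite !perm1.
by apply/implyP => /andP[].
Qed.

Lemma koszul1 (K : fieldType) n (d : 'I_n -> int) : koszul K d 1%g = 1.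
Proof.
rewrite /koszul big1 // => i _; rewrite big1 // => k.
by rewrite !perm1; case: ltngtP.
Qed.

Lemma sum_shuffle_le1 (U : nmodType) n i (F : 'S_n -> U) : (n <= 1)%N ->
  \sum_(s : 'S_n | shuffle i s) F s = F 1%g.
Proof.
move=> n1; apply: big_pred1 => s.
have -> : s = 1%g; last by rewrite shuffle1 /= eqxx.
apply/permP => k; rewrite perm1; apply: val_inj.
by have := ltn_ord k; have := ltn_ord (s k); rewrite /=; lia.
Qed.

(** * Derived brackets *)

(** The situation after the components of a curved V-data have been sorted by
    weight. The map [j] embeds an abelian graded subalgebra [U] into a graded Lie
    algebra [V], and [T + M + B] is a square-zero element of degree 1; the
    hypotheses on brackets of [T], [M] and [B] are the homogeneous parts of its
    Maurer-Cartan equation. The derived brackets of [T], [M] and [B] with the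
    elements of [U] have 0, 1 and 2 arguments. *)
Section DerivedBrackets.
Variables (K : fieldType) (U V : lmodType K).
Variables (GU : int -> set U) (GV : int -> set V) (br : V -> V -> V).
Variables (j : {linear U -> V}) (B M T : V).
Variables (l0 : U) (l1 : U -> U) (l2 : U -> U -> U).
Hypotheses (K2 : (2 : K) != 0) (gU : grading GU) (Lie : graded_Lie GV br).
Hypotheses (jI : injective j) (jdeg : forall i x, GU i x <-> GV i (j x)).
Hypothesis jab : forall x y, br (j x) (j y) = 0.
Hypotheses (B1 : GV 1 B) (M1 : GV 1 M) (T1 : GV 1 T).
Hypotheses (l0E : j l0 = T) (l1E : forall x, j (l1 x) = br M (j x)).
Hypothesis l2E : forall x y, j (l2 x y) = br (br B (j x)) (j y).
Hypotheses (MT : br M T = 0) (MMBT : br M M + 2 *: br B T = 0).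
Hypotheses (MB : br M B = 0) (BB : br B B = 0).
Implicit Types u v w : V.

Definition derived_bracket (k : nat) : ('I_k -> U) -> U :=
  match k return ('I_k -> U) -> U with
  | 0%N => fun=> l0
  | 1%N => fun a => l1 (a ord0)
  | 2%N => fun a => l2 (a ord0) (a ord_max)
  | _ => fun=> 0
  end.

Let br_degree i k u v := @gLie_degree K V GV br Lie i k u v.
Let br_antisym i k u v := @gLie_antisym K V GV br Lie i k u v.
Let br_jacobi i k n u v w := @gLie_jacobi K V GV br Lie i k n u v w.

Lemma brDr u v w : br u (v + w) = br u v + br u w.
Proof. by have := gLie_linearr Lie u 1 v w; rewrite !scale1r. Qed.
Lemma brDl u v w : br (v + w) u = br v u + br w u.
Proof. by have := gLie_linearl Lie u 1 v w; rewrite !scale1r. Qed.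
Lemma br0r u : br u 0 = 0.
Proof. by apply: (addrI (br u 0)); rewrite -brDr !addr0. Qed.
Lemma br0l u : br 0 u = 0.
Proof. by apply: (addrI (br 0 u)); rewrite -brDl !addr0. Qed.
Lemma brZr a u v : br u (a *: v) = a *: br u v.
Proof. by have := gLie_linearr Lie u a v 0; rewrite !addr0 br0r addr0. Qed.
Lemma brZl a u v : br (a *: u) v = a *: br u v.
Proof. by have := gLie_linearl Lie v a u 0; rewrite !addr0 br0l addr0. Qed.

Lemma linear_half (u : V) : 2 *: u = 0 -> u = 0.
Proof. by move/eqP; rewrite scaler_eq0 (negPf K2) => /eqP. Qed.

Let signE := (mul1r, mulr1, ksignE, parityD, parityM,
  erefl : parity 1 = true).

(** Bracketing [B] with [br u v = 0] gives the graded symmetry of the binary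
    derived bracket. *)
Lemma derived_symm i k u v : GV i u -> GV k v -> br u v = 0 ->
  br (br B u) v = ksign K (i * k) *: br (br B v) u.
Proof.
move=> ui vk uv; have := br_jacobi B1 ui vk.
rewrite uv br0r (br_antisym ui (br_degree B1 vk)) !signE.
move/esym/eqP; rewrite addr_eq0 => /eqP ->.
by case: (parity i) (parity k) => -[]; rewrite ?expr0 ?expr1 /=; sqzero; ring.
Qed.

(** The square of [br M] is half the bracket with [br M M]. *)
Lemma derived_rel1 x i : GU i x ->
  br (br B T) (j x) + br M (br M (j x)) = 0.
Proof.
move=> /jdeg xi; have := br_jacobi M1 M1 xi; rewrite !signE expr1.
move: MMBT => /eqP; rewrite addr_eq0 => /eqP ->.
rewrite -scaleN1r scalerA brZl => E; apply: linear_half.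
rewrite scalerDr [2 *: br M _]scalerDl !scale1r {1}E.
by sqzero; ring.
Qed.

(** [br M] is a derivation that anticommutes with [br B], because [br M B = 0]. *)
Lemma derived_rel2 x y i k : GU i x -> GU k y ->
  br (br B (br M (j x))) (j y) +
  ksign K (i * k) *: br (br B (br M (j y))) (j x) +
  br M (br (br B (j x)) (j y)) = 0.
Proof.
move=> /jdeg xi /jdeg yk.
have anti u n : GV n u -> br M (br B u) = - br B (br M u).
  move=> un; rewrite (br_jacobi M1 B1 un) MB br0l add0r !signE expr1.
  by rewrite scaleN1r.
rewrite (br_jacobi M1 (br_degree B1 xi) yk) (anti _ _ xi).
have -> : br (br B (j x)) (br M (j y)) = ksign K (i * (1 + k)) *:
    br (br B (br M (j y))) (j x).
  by apply: derived_symm => //; [apply: br_degree | rewrite -l1E].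
rewrite !signE -[- br B _]scaleN1r brZl.
by case: (parity i) (parity k) => -[]; rewrite ?expr0 ?expr1 /=; sqzero; ring.
Qed.

(** As [br B] squares to zero, the bracket of [br B (j x)] and [br B (j y)] is, up
    to sign, the image under [br B] of the binary bracket of [x] and [y]; its
    bracket with [j z] is then expanded by the Jacobi identity. *)
Lemma derived_rel3 x y z i k n : GU i x -> GU k y -> GU n z ->
  br (br B (br (br B (j x)) (j y))) (j z) +
  ksign K (k * n) *: br (br B (br (br B (j x)) (j z))) (j y) +
  ksign K (i * (k + n)) *: br (br B (br (br B (j y)) (j z))) (j x) = 0.
Proof.
move=> /jdeg xi' /jdeg yk' /jdeg zn'.
have BBu u m : GV m u -> br B (br B u) = 0.
  move=> um; have := br_jacobi B1 B1 um; rewrite BB br0l add0r !signE expr1.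
  move=> E; apply: linear_half.
  by rewrite mulr2n scalerDl !scale1r {2}E scaleN1r subrr.
have -> : br B (br (br B (j x)) (j y)) =
    - ksign K i *: br (br B (j x)) (br B (j y)).
  rewrite (br_jacobi B1 (br_degree B1 xi') yk') (BBu _ _ xi') br0l add0r !signE.
  by case: (parity i); rewrite ?expr0 ?expr1 ?opprK.
rewrite brZl; have := br_jacobi (br_degree B1 xi') (br_degree B1 yk') zn'.
move/eqP; rewrite -subr_eq => /eqP <-.
have E a b d p q r : GV p (j a) -> GV q (j b) -> GV r (j d) ->
    br (br B (j a)) (br (br B (j b)) (j d)) =
    ksign K (p * (1 + q + r)) *: br (br B (br (br B (j b)) (j d))) (j a).
  move=> pa qb rd; apply: derived_symm => //; last by rewrite -l2E.
  by apply: br_degree => //; apply: br_degree.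
rewrite (E _ _ _ _ _ _ xi' yk' zn') (E _ _ _ _ _ _ yk' xi' zn') !signE.
by case: (parity i) (parity k) (parity n) => -[] [];
  rewrite ?expr0 ?expr1 /=; sqzero; ring.
Qed.

Lemma derived_bracket_ge3 k x : (3 <= k)%N -> @derived_bracket k x = 0.
Proof. by case: k x => [|[|[|k]]]. Qed.

Lemma derived_bracket0 k (x : 'I_k -> U) : derived_bracket (fcons 0 x) = 0.
Proof.
case: k x => [|[|k]] x //=; apply: jI; rewrite linear0.
  by rewrite l1E fcons0 linear0 br0r.
by rewrite l2E fcons0 linear0 br0r br0l.
Qed.

(** A composite of two of the brackets with [n] arguments in total vanishes unless
    both have at most two inputs; so at most two inner arities are left for
    [n <= 3], and none for larger [n]. *)
Lemma derived_relations n (d : 'I_n -> int) (x : 'I_n -> U) :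
  (forall i, GU (d i) (x i)) ->
  \sum_(i < n.+1) \sum_(s : 'S_n | shuffle i s) koszul K d s *:
    derived_bracket (fcons
      (derived_bracket (@firsts _ U n i (fun k => x (s k))))
      (@lasts _ U n i (fun k => x (s k)))) = 0.
Proof.
move=> xd.
have vanish (i : 'I_n.+1) : (2 < i)%N || (i.+1 < n)%N ->
    \sum_(s : 'S_n | shuffle i s) koszul K d s *:
    derived_bracket (fcons
      (derived_bracket (@firsts _ U n i (fun k => x (s k))))
      (@lasts _ U n i (fun k => x (s k)))) = 0.
  case/orP=> [i3|ni]; apply: big1 => s _.
    by rewrite [X in fcons X]derived_bracket_ge3 // derived_bracket0 scaler0.
  by rewrite derived_bracket_ge3 ?scaler0 // ltnS ltn_subRL addn1.
case: n d x xd vanish => [|[|[|[|n]]]] d x xd vanish; last first.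
- by apply: big1 => i _; apply: vanish; case: ltnP => // i2; lia.
- rewrite (bigD1 (Ordinal (isT : 2 < 4)%N)) //=.
  rewrite [X in _ + X]big1 ?addr0; last first.
    by move=> i i2; apply: vanish; move: i2; rewrite -val_eqE /=; lia.
  pose a : 'I_3 := Ordinal (isT : 0 < 3)%N.
  pose b : 'I_3 := Ordinal (isT : 1 < 3)%N.
  pose c : 'I_3 := Ordinal (isT : 2 < 3)%N.
  transitivity (\sum_(s : 'S_3 | shuffle 2 s) koszul K d s *:
     l2 (l2 (x (s a)) (x (s b))) (x (s c))).
    apply: eq_bigr => s _; set xs := fun k => x (s k).
    pose f := @firsts _ U 3 (Ordinal (isT : 2 < 4)%N) xs.
    pose t : 'I_1 -> U := @lasts _ U 3 (Ordinal (isT : 2 < 4)%N) xs.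
    pose v := l2 (f ord0) (f ord_max).
    transitivity
      (koszul K d s *: l2 (fcons v t ord0) (fcons v t ord_max)) => //.
    rewrite fcons0 fcons_max /v /f /t /firsts /lasts /xs.
    by congr (_ *: l2 (l2 (x (s _)) (x (s _))) (x (s _))); apply: val_inj.
  rewrite (@shuffle_2_1 _ _ a b c) // !(@koszul3 _ _ _ a b c) //.
  have E1 : tperm b c a = a by rewrite tpermD.
  have E2 : tperm a c b = b by rewrite tpermD.
  have E3 : tperm a b c = c by rewrite tpermD.
  rewrite !permM !perm1 !(tpermL, tpermR, E1, E2, E3) /= !mulr1 !mul1r scale1r.
  apply: jI; rewrite linear0 !linearD !linearZ !l2E.
  rewrite -(derived_rel3 (xd a) (xd b) (xd c)) /= !signE.
  by case: (parity (d a)) (parity (d b)) (parity (d c)) => -[] [];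
    rewrite ?expr0 ?expr1 /=; sqzero; ring.
- - pose i1 : 'I_3 := Ordinal (isT : 1 < 3)%N.
  pose i2 : 'I_3 := Ordinal (isT : 2 < 3)%N.
  rewrite (bigD1 (Ordinal (isT : 1 < 3)%N)) //.
  rewrite (bigD1 (Ordinal (isT : 2 < 3)%N)) //=.
  rewrite [X in _ + (_ + X)]big1 ?addr0; last first.
    move=> i /andP[i1' i2']; apply: vanish; move: i1' i2'.
    by rewrite -!val_eqE /=; lia.
  transitivity (\sum_(s : 'S_2 | shuffle 1 s) koszul K d s *:
       l2 (l1 (x (s ord0))) (x (s ord_max)) +
     \sum_(s : 'S_2 | shuffle 2 s) koszul K d s *:
       l1 (l2 (x (s ord0)) (x (s ord_max)))).
    congr (_ + _); apply: eq_bigr => s _; set xs := fun k => x (s k).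
      pose f := @firsts _ U 2 i1 xs; pose t : 'I_1 -> U := @lasts _ U 2 i1 xs.
      pose v := l1 (f ord0).
      transitivity
        (koszul K d s *: l2 (fcons v t ord0) (fcons v t ord_max)) => //.
      rewrite fcons0 fcons_max /v /f /t /firsts /lasts /xs.
      by congr (_ *: l2 (l1 (x (s _))) (x (s _))); apply: val_inj.
    pose f := @firsts _ U 2 i2 xs; pose t : 'I_0 -> U := @lasts _ U 2 i2 xs.
    pose v := l2 (f ord0) (f ord_max).
    transitivity (koszul K d s *: l1 (fcons v t ord0)) => //.
    rewrite fcons0 /v /f /firsts /xs.
    by congr (_ *: l1 (l2 (x (s _)) (x (s _)))); apply: val_inj.
  have sh1 : shuffle 1 (tperm ord0 ord_max : 'S_2).
    apply/forallP => a; apply/forallP => b.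
    by case: a b => -[|[|//]] ? [[|[|//]] ?].
  have sh2 : shuffle 2 (tperm ord0 ord_max : 'S_2) = false.
    apply/negP => /forallP/(_ ord0)/forallP/(_ ord_max).
    by rewrite tpermL tpermR.
  rewrite !sum_perm2 !shuffle1 sh1 sh2 !koszul2 !perm1 tpermL tpermR /=.
  rewrite !scale1r addr0; apply: jI.
  rewrite linear0 !linearD !linearZ l1E !l2E !l1E.
  rewrite -(derived_rel2 (xd ord0) (xd ord_max)) /= !signE.
  by case: (parity (d ord0)) (parity (d ord_max)) => -[];
    rewrite ?expr0 ?expr1 /=; sqzero; ring.
- pose i0 : 'I_2 := Ordinal (isT : 0 < 2)%N.
  pose i1 : 'I_2 := Ordinal (isT : 1 < 2)%N.
  rewrite (bigD1 (Ordinal (isT : 0 < 2)%N)) //.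
  rewrite (bigD1 (Ordinal (isT : 1 < 2)%N)) //=.
  rewrite [X in _ + (_ + X)]big1 ?addr0; last first.
    by move=> i /andP[i1' i2']; case: i i1' i2' => -[|[|//]].
  rewrite !sum_shuffle_le1 //.
  set xs := fun k => x _.
  pose f := @firsts _ U 1 i1 xs; pose t : 'I_1 -> U := @lasts _ U 1 i0 xs.
  pose t' : 'I_0 -> U := @lasts _ U 1 i1 xs.
  transitivity (koszul K d 1%g *: l2 (fcons l0 t ord0) (fcons l0 t ord_max) +
     koszul K d 1%g *: l1 (fcons (l1 (f ord0)) t' ord0)) => //.
  rewrite koszul1 !scale1r !fcons0 fcons_max.
  have -> : f ord0 = x ord0 by rewrite /f /firsts /xs ord1.
  have -> : t ord0 = x ord0 by rewrite /t /lasts /xs ord1.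
  by apply: jI; rewrite linear0 linearD l2E !l1E l0E (derived_rel1 (xd ord0)).
rewrite big_ord1 sum_shuffle_le1 // koszul1 scale1r.
pose t : 'I_0 -> U := @lasts _ U 0 ord0 (fun k => x ((1%g : 'S_0) k)).
transitivity (l1 (fcons l0 t ord0)) => //.
by apply: jI; rewrite fcons0 l1E l0E MT linear0.
Qed.

Theorem derived_brackets_Linfty : curved_Linfty GU derived_bracket.
Proof.
split=> //; last exact: derived_relations.
- move=> [|[|[|k]]] x i c u v /=; first by case: i.
  + rewrite (ord1 i) /upd eqxx; apply: jI.
    by rewrite linearD linearZ !l1E linearD linearZ brDr brZr.
  + rewrite /upd; apply: jI; rewrite linearD linearZ !l2E.
    case: i => -[|[|//]] ilt; rewrite -!val_eqE /=.
      by rewrite linearD linearZ !(brDr, brDl, brZr, brZl).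
    by rewrite linearD linearZ !(brDr, brDl, brZr, brZl).
  + by rewrite scaler0 addr0.
- move=> [|[|[|k]]] d x xd /=.
  + by rewrite big_ord0 add0r jdeg l0E.
  + by rewrite big_ord1 addrC jdeg l1E; apply: br_degree => //; apply/jdeg.
  + rewrite big_ord_recl big_ord1 addrC addrA jdeg l2E; apply: br_degree.
      by apply: br_degree => //; apply/jdeg.
    by apply/jdeg; have -> : ord_max = lift ord0 ord0 :> 'I_2 by apply: val_inj.
  + by have [] := grading_subspace gU (\sum_(i < k.+3) d i + 1).
move=> [|[|[|k]]] s d x xd /=.
- by rewrite /koszul big_ord0 scale1r.
- by rewrite /koszul big_ord1 big_mkcond big_ord1 /= scale1r (ord1 (s _)).
- have /orP[/eqP->|/eqP->] : (s == 1%g) || (s == tperm ord0 ord_max).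
    have := sum_perm2 (pred1 s) (fun=> 1%N); rewrite big_pred1_eq /=.
    by rewrite ![_ == s]eq_sym; case: eqP; case: eqP.
  + by rewrite koszul1 !perm1 scale1r.
  rewrite koszul2 tpermL tpermR /=; apply: jI; rewrite linearZ !l2E.
  by apply: derived_symm => //; apply/jdeg.
by rewrite scaler0.
Qed.

End DerivedBrackets.

Arguments derived_bracket {K U} l0 l1 l2 k x.

(** * The curved V-data of a quasi-twilled algebra *)

(** Subtracting [a] times the relation from its image under [T] removes the first
    eigenvector and rescales the others by nonzero factors. *)
Lemma eigenvectors_free (K : fieldType) (V : lmodType K) (T : {linear V -> V})
    (s : seq (K * V)) :
  uniq (map fst s) -> (forall p, p \in s -> T p.2 = p.1 *: p.2) ->
  \sum_(p <- s) p.2 = 0 -> forall p, p \in s -> p.2 = 0.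
Proof.
elim: {s}(size s) {-2}s (erefl (size s)) => [|n IH] [//|[a v] s] //= [sn].
move=> /andP[as_ us] eig; rewrite big_cons /= => vs.
have Ta p : p \in s -> T p.2 = p.1 *: p.2.
  by move=> ps; apply: eig; rewrite inE ps orbT.
have Tv : T v = a *: v by apply: (eig (a, v)); rewrite inE eqxx.
pose s' := [seq (p.1, (p.1 - a) *: p.2) | p <- s].
have s0 p : p \in s -> p.2 = 0.
  move=> ps; have : (p.1, (p.1 - a) *: p.2).2 = 0.
    apply: (IH s'); rewrite ?size_map // -?map_comp //.
    - by move=> _ /mapP[q qs ->] /=; rewrite linearZ Ta //= !scalerA mulrC.
    - have E : T (v + \sum_(p <- s) p.2) - a *: (v + \sum_(p <- s) p.2) = 0.
        by rewrite vs linear0 scaler0 subrr.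
      rewrite big_map -[RHS]E linearD linear_sum Tv scalerDr opprD addrACA.
      rewrite subrr add0r scaler_sumr -sumrB; apply: eq_big_seq => q qs.
      by rewrite /= Ta // scalerBl.
    - by apply/mapP; exists p.
  move=> /= /eqP; rewrite scaler_eq0 subr_eq0 => /orP[/eqP pa|/eqP //].
  by case/mapP: as_; exists p.
move: vs; rewrite big_seq big1 // addr0 => v0 p.
by rewrite inE => /orP[/eqP -> //|]; apply: s0.
Qed.

Section QuasiTwilledVdata.
Variables (K : fieldType) (charK : [pchar K] =i pred0).
Variables (A A' : lmodType K) (Q : quasi_twilled A A').
Notation W := (A * A')%type.

Lemma clift_linear : linear (@clift K A A').
Proof.
by move=> a f g; apply: dsumE => n; apply: (linearP (@lift_hom K A A' n.+1)).
Qed.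
HB.instance Definition _ := GRing.isLinear.Build K (cochains A A')
  (cochains W W) *:%R (@clift K A A') clift_linear.

Lemma cres_linear : linear (@cres K A A').
Proof. by move=> a f g; apply: dsumE => n; apply: homE. Qed.
HB.instance Definition _ := GRing.isLinear.Build K (cochains W W)
  (cochains A A') *:%R (@cres K A A') cres_linear.

Lemma projF_linear : linear (@projF K A A').
Proof. by move=> a x y; rewrite /projF !linearP. Qed.

Lemma lift_hom0 n (f : hom n A A') : lift_hom f = 0 -> f = 0.
Proof.
move=> f0; apply: homE => w.
by have := congr1 (fun g : hom n W W => (g (inA \o w)).2) f0.
Qed.

Lemma clift_deg i (f : cochains A A') :
  cochain_deg i f <-> cochain_deg i (clift f).
Proof.
split=> fi n ni.
  transitivity (lift_hom (f n)) => //.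
  by rewrite (_ : f n = 0) ?linear0 //; apply: fi.
apply: lift_hom0; exact: fi.
Qed.

Lemma clift_in n (f : hom n.+1 A A') :
  clift (cochain_in f) = cochain_in (lift_hom f).
Proof.
apply: dsumE => k; have [<-|nk] := eqVneq n k.
  by rewrite [RHS]dsum_in_eq; apply: congr1; rewrite [LHS]dsum_in_eq.
rewrite [RHS]dsum_in_neq //; transitivity (lift_hom (0 : hom k.+1 A A')).
  by apply: congr1; apply: dsum_in_neq.
exact: linear0.
Qed.

Lemma cres_in n (f : hom n.+1 W W) :
  cres (cochain_in f) = cochain_in (res_hom f : hom n.+1 A A').
Proof.
apply: dsumE => k; have [<-|nk] := eqVneq n k.
  by rewrite [RHS]dsum_in_eq; apply: congr1; rewrite [LHS]dsum_in_eq.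
rewrite [RHS]dsum_in_neq //; transitivity (res_hom (0 : hom k.+1 W W)).
  by apply: congr1; apply: dsum_in_neq.
exact: linear0.
Qed.

Lemma projF_eq0 (x : cochains W W) :
  projF x = 0 <-> forall n (w : 'I_n.+1 -> A), (x n (inA \o w)).2 = 0.
Proof.
split=> [x0 n w|x0]; last first.
  apply: dsumE => n; apply: homE => w.
  by transitivity ((0, (x n (inA \o (fst \o w))).2) : W) => //; rewrite x0.
have : (projF x n (inA \o w)).2 = (0 : W).2.
  by rewrite x0.
done.
Qed.

(** Weights add up: the bracket has weight 2, and so it vanishes. *)
Lemma Gerst_clift (f g : cochains A A') : Gerst (clift f) (clift g) = 0.
Proof.
apply: weight2_eq0 => //.
exact: weight_Gerst (clift_weight f) (clift_weight g).
Qed.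

(** The kernel of the projection onto [F] consists of the maps that send lists of
    elements of [A] to [A], and these can be composed. *)
Lemma circ_kernel m n N (e : N = (m + n)%N) (f : hom m.+1 W W)
    (g : hom n.+1 W W) :
  (forall w : 'I_m.+1 -> A, (f (inA \o w)).2 = 0) ->
  (forall w : 'I_n.+1 -> A, (g (inA \o w)).2 = 0) ->
  forall w : 'I_N.+1 -> A, (circ e f g (inA \o w)).2 = 0.
Proof.
move=> f0 g0 w.
transitivity (snd (circ_fun (N := N) f g (inA \o w : _ -> W))) => //.
rewrite linear_sum big1 //= => i _.
have -> : insert i g (inA \o w : 'I_N.+1 -> W) =
    inA \o (fst \o (insert i g (inA \o w : 'I_N.+1 -> W))) :> ('I_m.+1 -> W).
  apply: funext => j /=; rewrite [LHS]surjective_pairing; congr pair.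
  rewrite /insert; case: ifP => // _; case: ifP => // _.
  exact: (g0 (fun k => w (inord (i + k)))).
by rewrite f0 scaler0.
Qed.

Lemma Gerst_kernel (x y : cochains W W) :
  projF x = 0 -> projF y = 0 -> projF (Gerst x y) = 0.
Proof.
move=> /projF_eq0 x0 /projF_eq0 y0; apply/projF_eq0 => n w.
transitivity (snd ((Gerst_fun x y n) (inA \o w : _ -> W))) => //.
rewrite /Gerst_fun; elim/big_ind: _ => // [f g f0 g0|i _].
  by transitivity ((f (inA \o w)).2 + (g (inA \o w)).2); rewrite // f0 g0 addr0.
rewrite /gbr; set c1 := circ _ _ _; set c2 := circ _ _ _.
transitivity ((c1 (inA \o w)).2 -
  (-1) ^+ (i * (n - i)) *: (c2 (inA \o w)).2) => //.
by rewrite !circ_kernel // scaler0 subrr.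
Qed.

(** The parts of weight 0, -1 and 1 of the multiplication [Delta]. *)
Definition Delta0 : cochains W W := cochain_in (lpi Q + lrho Q + lmu Q).
Definition DeltaN1 : cochains W W := cochain_in (lxi Q + leta Q + lbeta Q).
Definition Delta1 : cochains W W := cochain_in (ltheta Q).
Definition Delta : cochains W W := cochain_in
  (lpi Q + lxi Q + leta Q + lbeta Q + lrho Q + lmu Q + ltheta Q).

Lemma DeltaE : Delta = Delta1 + Delta0 + DeltaN1.
Proof.
rewrite /Delta1 /Delta0 /DeltaN1 /cochain_in -!linearD /Delta.
by congr dsum_in; sqzero; ring.
Qed.

Let fstA (w : W) : (inA' w.2 : W).1 = 0 *: w.1. Proof. by rewrite scale0r. Qed.
Let sndA' (w : W) : (inA' w.2 : W).2 = 1 *: w.2. Proof. by rewrite scale1r. Qed.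
Let inAA' (z : A) : inA' (inA z : W).2 = 0 *: inA z :> W.
Proof. by rewrite scale0r. Qed.
Let inA'A' (z : A') : inA' (inA' z : W).2 = 1 *: inA' z :> W.
Proof. by rewrite scale1r. Qed.

Lemma weight_Delta1 : weight 1 Delta1.
Proof.
by have := lift2_weight (qt_theta Q) fstA fstA inA'A'; rewrite !subr0.
Qed.

Lemma weight_Delta0 : weight 0 Delta0.
Proof.
rewrite /Delta0 /cochain_in !linearD; do 2?apply: weightD.
- by have := lift2_weight (qt_pi Q) fstA fstA inAA'; rewrite !subr0.
- by have := lift2_weight (qt_rho Q) fstA sndA' inA'A'; rewrite subr0 subrr.
by have := lift2_weight (qt_mu Q) sndA' fstA inA'A'; rewrite subr0 subrr.
Qed.

Lemma weight_DeltaN1 : weight (-1) DeltaN1.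
Proof.
rewrite /DeltaN1 /cochain_in !linearD; do 2?apply: weightD.
- by have := lift2_weight (qt_xi Q) fstA sndA' inAA'; rewrite subr0 sub0r.
- by have := lift2_weight (qt_eta Q) sndA' fstA inAA'; rewrite subr0 sub0r.
by have := lift2_weight (qt_beta Q) sndA' sndA' inA'A'; rewrite subrr sub0r.
Qed.

Lemma Delta_square : Gerst Delta Delta = 0.
Proof.
rewrite /Delta (Gerst_in (erefl : 2 = (1 + 1)%N)) /gbr.
rewrite !(circ_associative _ (@qt_mul_lift _ _ _ Q) (@qt_assoc _ _ _ Q)).
by rewrite scaler0 subrr /cochain_in linear0.
Qed.

Lemma Gerst11C (x y : cochains W W) : cochain_deg 1 x -> cochain_deg 1 y ->
  Gerst x y = Gerst y x.
Proof.
move=> x1 y1; rewrite (gLie_antisym (Gerst_graded_Lie W) x1 y1).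
by rewrite mulr1 /ksign expr1z scaleN1r opprK.
Qed.

Let natK n : ((n%:R : K) == 0) = (n == 0%N).
Proof. exact: (pcharf0P K).1. Qed.

Lemma weights_uniq : uniq [:: 1; 0; -1; -2 : K].
Proof.
have neq (a b : K) n : a - b = n.+1%:R -> (a == b) = false.
  by move=> ab; rewrite -subr_eq0 ab natK.
rewrite /= !inE oner_eq0 (neq 1 (-1) 1%N) ?(neq 1 (-2) 2%N) ?(neq 0 (-1) 0%N)
  ?(neq 0 (-2) 1%N) ?(neq (-1) (-2) 0%N) //; ring.
Qed.

(** The parts of weight 1, 0, -1 and -2 of [Gerst Delta Delta = 0], which vanish
    separately because the weights are distinct in characteristic 0. *)
Lemma Delta_components :
  [/\ Gerst Delta0 Delta1 = 0,
      Gerst Delta0 Delta0 + 2 *: Gerst DeltaN1 Delta1 = 0,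
      Gerst Delta0 DeltaN1 = 0 & Gerst DeltaN1 DeltaN1 = 0].
Proof.
have [M1 B1 T1] : [/\ cochain_deg 1 Delta0, cochain_deg 1 DeltaN1
    & cochain_deg 1 Delta1] by split; apply: cochain_deg_in.
pose s : seq (K * cochains W W) :=
 [:: (1, 2 *: Gerst Delta0 Delta1);
  (0, Gerst Delta0 Delta0 + 2 *: Gerst DeltaN1 Delta1);
  (-1, 2 *: Gerst Delta0 DeltaN1);
  (-2, Gerst DeltaN1 DeltaN1)].
have sw p : p \in s -> Gerst (cochain_in (@proj2 K A A')) p.2 = p.1 *: p.2.
  have [wM wB wT] := And3 weight_Delta0 weight_DeltaN1 weight_Delta1.
  rewrite !inE => /or4P[] /eqP -> /=.
  - by have := weightZ 2 (weight_Gerst wM wT); rewrite add0r.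
  - apply: weightD; first by have := weight_Gerst wM wM; rewrite addr0.
    by have := weightZ 2 (weight_Gerst wB wT); rewrite addNr.
  - by have := weightZ 2 (weight_Gerst wM wB); rewrite add0r.
  by have := weight_Gerst wB wB; rewrite -opprD.
have TT : Gerst Delta1 Delta1 = 0.
  exact: weight2_eq0 (weight_Gerst weight_Delta1 weight_Delta1).
have s0 : \sum_(p <- s) p.2 = 0.
  rewrite !big_cons big_nil -[RHS]Delta_square DeltaE /=.
  rewrite !(GerstDl, linearD) /= TT (Gerst11C T1 M1) (Gerst11C T1 B1).
  rewrite (Gerst11C B1 M1).
  by sqzero; ring.
have E := eigenvectors_free (weights_uniq : uniq (map fst s)) sw s0.
have half (v : cochains W W) : 2 *: v = 0 -> v = 0.
  by move/eqP; rewrite scaler_eq0 natK => /eqP.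
split.
- by apply/half/(E (1, _)); rewrite inE eqxx.
- by apply: (E (0, _)); rewrite !inE eqxx orbT.
- by apply/half/(E (-1, _)); rewrite !inE eqxx !orbT.
by apply: (E (-2, _)); rewrite !inE eqxx !orbT.
Qed.

Lemma range_clift_graded_sub :
  graded_Lie_sub cochain_deg (@Gerst K W) (range (@clift K A A')).
Proof.
split; last first.
  by move=> _ _ [f _ <-] [g _ <-]; exists 0; rewrite // linear0 Gerst_clift.
apply: dsum_graded_subspace; last first.
  by move=> n _ [f _ <-]; exists (cochain_in (f n)) => //; apply: clift_in.
split; first by exists 0; rewrite // linear0.
by move=> a _ _ [f _ <-] [g _ <-]; exists (a *: f + g); rewrite // linearP.
Qed.

Lemma projF_kernel_graded_sub :
  graded_Lie_sub cochain_deg (@Gerst K W) [set x | @projF K A A' x = 0].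
Proof.
split; last by move=> x y; apply: Gerst_kernel.
apply: dsum_graded_subspace.
  split=> [|a u v /= u0 v0]; first by rewrite /= /projF !linear0.
  by rewrite projF_linear u0 v0 scaler0 addr0.
move=> n x /= x0; apply/projF_eq0 => k w; have [nk|nk] := eqVneq n k.
  by subst k; rewrite dsum_in_eq; move/projF_eq0: x0; apply.
by rewrite dsum_in_neq.
Qed.

Theorem curved_Vdata_quasi_twilled :
  curved_Vdata cochain_deg (@Gerst K W) (range (@clift K A A'))
    (@projF K A A') Delta.
Proof.
split.
- exact: Gerst_graded_Lie.
- exact: range_clift_graded_sub.
- by move=> _ _ [f _ <-] [g _ <-]; apply: Gerst_clift.
- exact: projF_linear.
- by move=> x; apply: projF_clift.
- apply/seteqP; split=> [_ [x _ <-]|_ [f _ <-]]; first by exists (cres x).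
  by exists (clift f) => //; apply: projF_clift.
- exact: projF_kernel_graded_sub.
- exact: cochain_deg_in.
exact: Delta_square.
Qed.

(** * The curved L-infinity algebra and its Maurer-Cartan elements *)

Definition curving : cochains A A' := cres Delta1.
Definition differential (f : cochains A A') : cochains A A' :=
  cres (Gerst Delta0 (clift f)).
Definition binary (f g : cochains A A') : cochains A A' :=
  cres (Gerst (Gerst DeltaN1 (clift f)) (clift g)).

Lemma clift_curving : clift curving = Delta1.
Proof. by apply: (weight1_projF charK); apply: weight_Delta1. Qed.

(** The derived brackets take their values in the lifted cochains because they
    have weight [0 + 1 = 1] and [-1 + 1 + 1 = 1]. *)
Lemma clift_differential f : clift (differential f) = Gerst Delta0 (clift f).
Proof.
apply: (weight1_projF charK).
by have := weight_Gerst weight_Delta0 (clift_weight f); rewrite add0r.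
Qed.

Lemma clift_binary f g :
  clift (binary f g) = Gerst (Gerst DeltaN1 (clift f)) (clift g).
Proof.
apply: (weight1_projF charK).
have wf := weight_Gerst weight_DeltaN1 (clift_weight f).
have := weight_Gerst wf (clift_weight g).
by rewrite addNr add0r.
Qed.

Notation brackets := (derived_bracket curving differential binary).

Theorem brackets_Linfty : curved_Linfty cochain_deg brackets.
Proof.
have [MT MMBT MB BB] := Delta_components.
apply: (@derived_brackets_Linfty K (cochains A A') (cochains W W) _ cochain_deg
  (@Gerst K W) (@clift K A A') DeltaN1 Delta0 Delta1) => //.
- by rewrite natK.
- exact: dsum_grading.
- exact: Gerst_graded_Lie.
- exact: can_inj (@cliftK K A A').
- exact: clift_deg.
- exact: Gerst_clift.
- exact: cochain_deg_in.
- exact: cochain_deg_in.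
- exact: cochain_deg_in.
- exact: clift_curving.
- exact: clift_differential.
exact: clift_binary.
Qed.

(** Beyond the third bracket the Maurer-Cartan series is zero, so its sum does
    not depend on where it is cut. *)
Lemma Maurer_CartanE (f : cochains A A') :
  Maurer_Cartan cochain_deg brackets f <->
  cochain_deg 0 f /\ curving + differential f + 2^-1 *: binary f f = 0.
Proof.
pose F k := (k`!%:R : K)^-1 *: brackets k (fun=> f).
have F3 N : (forall k, (N <= k)%N -> brackets k (fun=> f) = 0) ->
    \sum_(1 <= k < N) F k = differential f + 2^-1 *: binary f f.
  move=> lN; transitivity (\sum_(1 <= k < N + 3) F k).
    rewrite (big_nat_widen _ _ (N + 3)) ?leq_addr // big_mkcond /=.
    by apply: eq_bigr => k _; case: ltnP => // /lN Fk; rewrite /F Fk scaler0.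
  transitivity (\sum_(1 <= k < 3) F k).
    rewrite [RHS](big_nat_widen _ _ (N + 3)) ?leq_addl // [RHS]big_mkcond /=.
    apply: eq_bigr => k _; case: ltnP => // k3.
    by rewrite /F derived_bracket_ge3 ?scaler0.
  by rewrite /F big_nat_recl // big_nat1 /= invr1 scale1r.
have b3 k : (3 <= k)%N -> brackets k (fun=> f) = 0.
  by move=> k3; rewrite derived_bracket_ge3.
split=> [[f0 [N [lN MC]]]|[f0 MC]]; split=> //.
  by rewrite -addrA -(F3 N).
by exists 3%N; split=> //; rewrite -[RHS]MC -addrA -(F3 3%N).
Qed.

Lemma gbr_binary (e : 1 = (1 + 0)%N) (D : {linear A -> A'}) (f : hom 2 W W)
    (fv : W -> W -> W) (z : 'I_2 -> W) :
  (forall w : 'I_2 -> W, f w = fv (w ord0) (w ord_max)) ->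
  gbr e f (lift_hom (hom1 D)) z =
  fv (inA' (D (z ord0).1)) (z ord_max) + fv (z ord0) (inA' (D (z ord_max).1))
  - inA' (D (fv (z ord0) (z ord_max)).1).
Proof.
move=> fE; rewrite gbr_degree0 !big_ord_recl big_ord0 addr0 !fE.
have -> : lift ord0 ord0 = ord_max :> 'I_2 by apply: val_inj.
by [].
Qed.

(** Both sides of the deformation equation are read off on arguments in [A]. The
    binary bracket of [D] with itself counts every term twice, which the factor
    [1 / 2] of the Maurer-Cartan series compensates. *)
Lemma right_deformationE (D : {linear A -> A'}) :
  right_deformation_map Q D <->
  curving + differential (cochain_in (hom1 D)) +
    2^-1 *: binary (cochain_in (hom1 D)) (cochain_in (hom1 D)) = 0.
Proof.
pose m := lpi Q + lrho Q + lmu Q; pose b := lxi Q + leta Q + lbeta Q.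
pose d : hom 1 W W := lift_hom (hom1 D); pose e := erefl : 1 = (1 + 0)%N.
pose h : hom 2 A A' := res_hom (ltheta Q) + res_hom (gbr e m d) +
  2^-1 *: res_hom (gbr e (gbr e b d) d).
have -> : curving + differential (cochain_in (hom1 D)) +
    2^-1 *: binary (cochain_in (hom1 D)) (cochain_in (hom1 D)) = cochain_in h.
  rewrite /curving /differential /binary clift_in !(Gerst_in e) !cres_in /h.
  move: (res_hom _) (res_hom _) (res_hom _) => p1 p2 p3.
  by rewrite /cochain_in !linearD linearZ.
pose w x y : 'I_2 -> A := fun i => if i == ord0 then x else y.
pose mv (u v : W) : W :=
  (qt_pi Q u.1 v.1, qt_rho Q u.1 v.2 + qt_mu Q u.2 v.1).
pose bv (u v : W) : W :=
  (qt_xi Q u.1 v.2 + qt_eta Q u.2 v.1, qt_beta Q u.2 v.2).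
pose bdv (u v : W) : W := bv (inA' (D u.1)) v + bv u (inA' (D v.1))
  - inA' (D (bv u v).1).
have mE (z : 'I_2 -> W) : m z = mv (z ord0) (z ord_max).
  by congr pair; rewrite /= ?addr0 ?add0r.
have bE (z : 'I_2 -> W) : b z = bv (z ord0) (z ord_max).
  by congr pair; rewrite /= ?addr0 ?add0r.
have bdE (z : 'I_2 -> W) : gbr e b d z = bdv (z ord0) (z ord_max).
  exact: gbr_binary.
have hE x y : h (w x y) =
    qt_rho Q x (D y) + qt_mu Q (D x) y + qt_beta Q (D x) (D y) + qt_theta Q x y
    - D (qt_pi Q x y + qt_xi Q x (D y) + qt_eta Q (D x) y).
  transitivity ((ltheta Q (inA \o w x y)).2 + (gbr e m d (inA \o w x y)).2 +
    2^-1 *: (gbr e (gbr e b d) d (inA \o w x y)).2) => //.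
  rewrite (gbr_binary _ _ _ mE) (gbr_binary _ _ _ bdE) /=.
  rewrite !(linear0, linear0l, addr0, add0r, oppr0).
  have half (v : A') : v = 2^-1 *: (v + v).
    by rewrite -mulr2n -scaler_nat scalerA mulVf ?scale1r // natK.
  transitivity (qt_theta Q x y + (qt_mu Q (D x) y + qt_rho Q x (D y)
      - D (qt_pi Q x y)) + (qt_beta Q (D x) (D y) - D (qt_eta Q (D x) y)
      - D (qt_xi Q x (D y)))); last by rewrite !(linearD D); sqzero; ring.
  rewrite [X in _ = _ + X]half (linearD D); congr (_ + _ *: _).
  by sqzero; ring.
split=> [Dd|h0 x y].
  suff -> : h = 0 by rewrite /cochain_in linear0.
  apply: homE => z; have -> : z = w (z ord0) (z ord_max).
    apply: funext => -[[|[|//]] i2]; rewrite /w -val_eqE /=;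
      by congr z; apply: val_inj.
  by rewrite hE Dd subrr.
have {h0} h0 : h = 0.
  rewrite -[h](@dsum_in_eq K (fun n => hom n.+1 A A') 1%N).
  by rewrite -/(cochain_in h) h0.
apply/esym/eqP; rewrite -subr_eq0; apply/eqP.
by rewrite -hE h0.
Qed.

End QuasiTwilledVdata.

Theorem theorem3p15 (K : fieldType) (charK : [pchar K] =i pred0)
    (A A' : lmodType K) (Q : quasi_twilled A A') :
  curved_Vdata cochain_deg (@Gerst K (A * A')%type)
    (range (@clift K A A')) (@projF K A A')
    (cochain_in
       (lpi Q + lxi Q + leta Q + lbeta Q + lrho Q + lmu Q + ltheta Q)) /\
  exists l : forall k, ('I_k -> cochains A A') -> cochains A A',
    [/\ [/\ forall x, clift (l 0%N x) = cochain_in (ltheta Q),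
            forall x, clift (l 1%N x) =
              Gerst (cochain_in (lpi Q + lrho Q + lmu Q)) (clift (x ord0)),
            forall x, clift (l 2%N x) =
              Gerst (Gerst (cochain_in (lxi Q + leta Q + lbeta Q))
                           (clift (x ord0)))
                    (clift (x ord_max))
          & forall k x, (3 <= k)%N -> l k x = 0],
        curved_Linfty cochain_deg l
      & forall D : {linear A -> A'},
          right_deformation_map Q D <->
          Maurer_Cartan cochain_deg l (cochain_in (hom1 D))].
Proof.
split; first exact: curved_Vdata_quasi_twilled.
exists (derived_bracket (curving Q) (differential Q) (binary Q)); split.
- split=> [x|x|x|k x k3].
  + exact: clift_curving.
  + exact: clift_differential.
  + exact: clift_binary.
  exact: derived_bracket_ge3.
- exact: brackets_Linfty.
move=> D; split=> [/(right_deformationE charK)MC|/Maurer_CartanE[_ MC]].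
  by apply/Maurer_CartanE; split=> //; apply: dsum_deg_in.
exact/(right_deformationE charK).
Qed.
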